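(* Let $\varphi\colon(0,\infty)\to(0,\infty)$ be a function such that $\varphi$ and $t\mapsto t/\varphi(t)$ are non-decreasing, and let $\Gamma$ and $\Lambda$ be finitely generated groups. Assume that we are in one of the following situations: \begin{itemize} \item[(i)] $\Gamma$ is a $\varphi$-integrable measure quotient of $\Lambda$; \item[(ii)] $\Gamma$ is an at most $m$-to-one $\varphi$-integrable measure sub-quotient of $\Lambda$, for some $m\in\mathbb N$. \end{itemize} Then $j_{1,\Gamma}\succcurlyeq\varphi\circ j_{1,\Lambda}$.
   Context: Isoperimetric profile. For a finitely generated group $G$ with finite symmetric generating set $S_G$ and $f\colon G\to\mathbb R$ finitely supported, put $\|\nabla^l_{S_G} f\|_1=\sum_{g\in G,\,s\in S_G}|f(sg)-f(g)|$, and $j_{1,G}(n)=\sup\left\{\|f\|_1/\|\nabla^l_{S_G} f\|_1\colon f\neq 0,\ |\operatorname{supp} f|\le n\right\}$ (the ratio is $+\infty$ if the gradient vanishes, which can only happen if $G$ is finite; $\varphi(+\infty)$ means $\sup\varphi$). For monotone functions, $g\succcurlyeq f$ means that there is a constant $C>0$ with $f(n)=O(g(Cn))$ as $n\to\infty$. Measure couplings. Let $S_\Lambda$ be a finite symmetric generating set of $\Lambda$. A measure sub-quotient coupling from $\Gamma$ to $\Lambda$ is a triple $(\Omega,X_\Lambda,\mu)$ where $(\Omega,\mu)$ is a standard Borel space with a nonzero $\sigma$-finite measure, equipped with commuting measure-preserving actions of $\Gamma$ and $\Lambda$ (denoted $*$), each admitting a fundamental domain (a Borel set meeting almost every orbit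 in exactly one point), such that the $\Gamma$-action is free (up to null sets) and $X_\Lambda$ is a fundamental domain of finite measure for the $\Lambda$-action (the $\Lambda$-action is not assumed to be free). It is a measure quotient coupling if moreover the $\Gamma$-action has a fundamental domain of finite measure. The group $\Gamma$ acts on $X_\Lambda$ by $\{\gamma\cdot x\}=(\Lambda*\gamma*x)\cap X_\Lambda$. For $y\in\Lambda*x$ put $d_{S_\Lambda}(x,y)=\min\{n\colon \exists s_1,\dots,s_n\in S_\Lambda,\ y=s_1\cdots s_n*x\}$. The coupling is $\varphi$-integrable if for every $\gamma\in\Gamma$ there is $c_\gamma>0$ with $\int_{X_\Lambda}\varphi\left(d_{S_\Lambda}(\gamma\cdot x,\gamma*x)/c_\gamma\right)d\mu(x)<\infty$ (the value $\varphi(0)$ may be fixed arbitrarily in $[0,\inf\varphi]$; it is irrelevant since $\mu(X_\Lambda)<\infty$). It is at most $m$-to-one if for every $x\in X_\Lambda$ the map $\Gamma\to\Lambda*x$, $\gamma\mapsto\gamma^{-1}*(\gamma\cdot x)$, has preimages of points of size at most $m$. The group $\Gamma$ is a $\varphi$-integrable measure quotient (resp. at most $m$-to-one $\varphi$-integrable measure sub-quotient) of $\Lambda$ if there is such a quotient (resp. sub-quotient) coupling from $\Gamma$ to $\Lambda$. *)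

(* Defs.v *)
From HB Require Import structures.
From mathcomp Require Import all_boot all_order all_algebra finmap.
From mathcomp Require Import all_classical all_reals all_analysis.
Import Order.TTheory GRing.Theory Num.Theory numFieldNormedType.Exports.
Set Implicit Arguments.
Unset Strict Implicit.
Unset Printing Implicit Defensive.
Local Open Scope classical_set_scope.
Local Open Scope ring_scope.

Definition symmetric_generating (G : groupType) (S : {fset G}) : Prop :=
  (forall s, s \in S -> (s^-1)%g \in S) /\
  forall g, exists2 w : seq G, {subset w <= S} & g = (\prod_(s <- w) s)%g.

Definition norm1 (R : realType) (G : groupType) (f : G -> R) : R :=
  \sum_(g \in [set: G]) `|f g|.

Definition grad_norm1 (R : realType) (G : groupType) (S : {fset G})
    (f : G -> R) : R :=
  \sum_(g \in [set: G]) \sum_(s <- S) `|f (s * g)%g - f g|.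

Definition profile_ratio (R : realType) (G : groupType) (S : {fset G})
    (f : G -> R) : \bar R :=
  if grad_norm1 S f == 0 then +oo%E else (norm1 f / grad_norm1 S f)%:E.

(* The argument is a real number, so that [j (C * n)] makes sense for real [C].
   For [t < 1] this is the supremum of the empty set, i.e. [-oo]. *)
Definition iso_profile (R : realType) (G : groupType) (S : {fset G})
    (t : R) : \bar R :=
  ereal_sup [set profile_ratio S f | f in [set f : G -> R |
    [/\ exists g, f g != 0,
        finite_set [set g | f g != 0] &
        (#|` fset_set [set g | f g != 0]|%fset)%:R <= t]]].

(* The value at [-oo] is junk: it is only met at arguments [t < 1]
   of [iso_profile]. *)
Definition ext_fun (R : realType) (phi : R -> R) (x : \bar R) : \bar R :=
  match x with
  | r%:E => (phi r)%:E
  | +oo%E => ereal_sup [set (phi t)%:E | t in [set t : R | 0 < t]]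
  | -oo%E => 0%E
  end.

Definition dominates (R : realType) (g f : R -> \bar R) : Prop :=
  exists C K : R, [/\ 0 < C, 0 < K &
    \forall n \near \oo, (f n%:R <= K%:E * g (C * n%:R)%R)%E].

(* Borel isomorphic to a Polish space; a Hausdorff complete pseudometric space
   is completely metrizable. *)
Definition standard_borel (R : realType) (d : measure_display)
    (T : measurableType d) : Prop :=
  exists (P : completePseudoMetricType R) (h : T -> P),
    [/\ hausdorff_space P, @second_countable P, bijective h &
        forall A : set T,
          measurable A <-> <<s [set U : set P | open U] >> (h @` A)].

Definition is_group_action (G : groupType) (T : Type) (a : G -> T -> T) : Prop :=
  (forall x, a 1%g x = x) /\ forall g h x, a (g * h)%g x = a g (a h x).

Definition act_orbit (G : groupType) (T : Type) (a : G -> T -> T) (x : T) :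
  set T := range (a^~ x).

Section Couplings.
Context (R : realType) (d : measure_display) (T : measurableType d).
Variable mu : {measure set T -> \bar R}.

Definition measure_preserving_action (G : groupType) (a : G -> T -> T) : Prop :=
  [/\ is_group_action a,
      forall g, measurable_fun setT (a g) &
      forall g (A : set T), measurable A -> mu (a g @^-1` A) = mu A].

Definition fundamental_domain (G : groupType) (a : G -> T -> T) (X : set T) :
    Prop :=
  measurable X /\ {ae mu, forall x, exists! y, (act_orbit a x `&` X) y}.

Definition ae_free (G : groupType) (a : G -> T -> T) : Prop :=
  {ae mu, forall x, forall g, a g x = x -> g = 1%g}.

Variables (Gamma Lambda : groupType).
Variables (aG : Gamma -> T -> T) (aL : Lambda -> T -> T).

Record subquotient_coupling (XL : set T) : Prop := SubquotientCoupling {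
  coupling_standard : standard_borel R T ;
  coupling_sigma_finite : sigma_finite [set: T] mu ;
  coupling_nonzero : mu [set: T] <> 0%E ;
  coupling_mpG : measure_preserving_action aG ;
  coupling_mpL : measure_preserving_action aL ;
  coupling_commute : forall g l x, aG g (aL l x) = aL l (aG g x) ;
  coupling_freeG : ae_free aG ;
  coupling_domG : exists XG, fundamental_domain aG XG ;
  coupling_domL : fundamental_domain aL XL ;
  coupling_domL_fin : (mu XL < +oo)%E }.

Definition quotient_coupling (XL : set T) : Prop :=
  subquotient_coupling XL /\
  exists2 XG, fundamental_domain aG XG & (mu XG < +oo)%E.

(* [induced XL g x] is the point g . x of XL, with a junk value on the
   null set of points [x] at which it is not uniquely determined. *)
Definition induced (XL : set T) (g : Gamma) (x : T) : T :=
  xget x (act_orbit aL (aG g x) `&` XL).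

Definition induced_defined (XL : set T) (x : T) : Prop :=
  forall g, exists! y, (act_orbit aL (aG g x) `&` XL) y.

Definition word_reach (S : {fset Lambda}) (x y : T) (n : nat) : Prop :=
  exists w : seq Lambda,
    [/\ {subset w <= S}, size w = n & y = aL (\prod_(s <- w) s)%g x].

(* The least [n] with [word_reach S x y n]; 0 if [y] is not in the orbit
   of [x]. *)
Definition orbit_dist (S : {fset Lambda}) (x y : T) : nat :=
  match pselect (exists n, `[< word_reach S x y n >]) with
  | left ex => ex_minn ex
  | right _ => 0%N
  end.

Definition integrable_coupling (phi : R -> R) (S : {fset Lambda})
    (XL : set T) : Prop :=
  forall g : Gamma, exists2 c : R, 0 < c &
    (\int[mu]_(x in XL)
       (phi ((orbit_dist S (induced XL g x) (aG g x))%:R / c))%:E < +oo)%E.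

(* Points of XL at which the induced action is not defined are disregarded. *)
Definition at_most_to_one (m : nat) (XL : set T) : Prop :=
  forall x, XL x -> induced_defined XL x ->
    forall y,
      ([set g : Gamma | aG (g^-1)%g (induced XL g x) = y] #<= `I_m)%card.

End Couplings.

Definition integrable_quotient (R : realType) (phi : R -> R)
    (Gamma Lambda : groupType) (S : {fset Lambda}) : Prop :=
  exists (d : measure_display) (T : measurableType d)
    (mu : {measure set T -> \bar R})
    (aG : Gamma -> T -> T) (aL : Lambda -> T -> T) (XL : set T),
    quotient_coupling mu aG aL XL /\ integrable_coupling mu aG aL phi S XL.

Definition at_most_to_one_integrable_subquotient (R : realType) (m : nat)
    (phi : R -> R) (Gamma Lambda : groupType) (S : {fset Lambda}) : Prop :=
  exists (d : measure_display) (T : measurableType d)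
    (mu : {measure set T -> \bar R})
    (aG : Gamma -> T -> T) (aL : Lambda -> T -> T) (XL : set T),
    [/\ subquotient_coupling mu aG aL XL,
        integrable_coupling mu aG aL phi S XL &
        at_most_to_one aG aL m XL].

Arguments iso_profile {R G} S t.
Arguments integrable_quotient {R} phi Gamma {Lambda} S.
Arguments at_most_to_one_integrable_subquotient {R} m phi Gamma {Lambda} S.

(* Main.v *)
Require Import Defs.
From HB Require Import structures.
From mathcomp Require Import all_boot all_order all_algebra finmap.
From mathcomp Require Import all_classical all_reals all_analysis.
From mathcomp Require Import measurable_realfun ring lra.
Import Order.TTheory GRing.Theory Num.Theory numFieldNormedType.Exports.
Set Implicit Arguments.
Unset Strict Implicit.
Unset Printing Implicit Defensive.
Local Open Scope classical_set_scope.
Local Open Scope ring_scope.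

(* Write X and Y for the fundamental domains of Lambda and Gamma. A function
   f >= 0 on Lambda with t |grad f| <= |f| is lifted to the coupling space by
   F x = \sum_l f l * 1_X (l x), and F is then read along the orbits of Gamma.
   The lift has integral |f| mu(X). Moving by s in Gamma translates f by the
   cocycle, of length d at the point x of X, so that the displacement of F has
   integral at most \int_X min (2 |f|, d |grad f|), which is O(|f| / phi t)
   because min (2, d / t) <= (2 + c) phi (d / c) / phi t. By the mass transport
   principle these integrals are averages over Y of orbit sums, hence some
   orbit sees a function on Gamma with ratio at least of order phi t.
   It remains to choose this orbit among those on which F has support of size
   O(n) when f has support of size n. The return count of x, which is the
   number of g in Gamma with g x in X, is finite almost everywhere since its
   integral over Y is mu(X); it is thus bounded by some K on most of X. Mass
   transport and Markov's inequality then show that the orbits with supports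
   larger than 4 K n carry at most half of the mass of F. *)

Local Open Scope ereal_scope.

(** * Sums over countable index types and their integrals *)

Section CountableSums.
Context {R : realType} {I : choiceType}.

(** A partial inverse of an injection into [nat] enumerates [I]; numbers outside its range go to
    [None] and contribute 0. A single [e] serves all families, so a family depending on a point
    becomes a series of functions. *)
Lemma esum_countable : countable [set: I] -> exists e : nat -> option I,
  forall a : I -> \bar R, (forall i, 0 <= a i) ->
    \esum_(i in [set: I]) a i = \sum_(n <oo) oapp a 0 (e n).
Proof.
move=> /countable_injP[c cinj].
have {}cinj i j : c i = c j -> i = j by apply: cinj; rewrite inE.
pose e n := if pselect (exists i, c i = n) is left ex then Some (sval (cid ex))
            else None.
have eK i : e (c i) = Some i.
  rewrite /e; case: pselect => [ex|[]]; last by exists i.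
  by case: cid => j /= /cinj ->.
have eN n : ~ range c n -> e n = None.
  by rewrite /e => nc; case: pselect => // -[i ci]; case: nc; exists i.
exists e => a a0.
have h0 n : 0 <= oapp a 0 (e n) by case: (e n) => //=.
rewrite nneseries_esumT// [LHS](_ : _ = \esum_(n in range c) oapp a 0 (e n)).
  rewrite esum_mkcond; apply: eq_esum => n _.
  by case: ifPn => //; rewrite notin_setE => /eN ->.
rewrite esum_image; last by move=> i j _ _; exact: cinj.
by apply: eq_esum => i _; rewrite eK.
Qed.

Lemma ge0_esumZl (k : R) (a : I -> \bar R) : countable [set: I] ->
  (forall i, 0 <= a i) -> (0 <= k)%R ->
  \esum_(i in [set: I]) (k%:E * a i) = k%:E * \esum_(i in [set: I]) a i.
Proof.
move=> cI a0 k0; have [e eP] := esum_countable cI.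
rewrite !eP// => [|i]; last by rewrite mule_ge0// lee_fin.
rewrite -nneseriesZl => [|n _]; last by case: (e n) => /=.
by apply: eq_eseriesr => n _; case: (e n) => //=; rewrite mule0.
Qed.

Context d (T : measurableType d) (mu : {measure set T -> \bar R}).

Lemma measurable_esum (f : I -> T -> \bar R) : countable [set: I] ->
  (forall i x, 0 <= f i x) -> (forall i, measurable_fun setT (f i)) ->
  measurable_fun setT (fun x => \esum_(i in [set: I]) f i x).
Proof.
move=> cI f0 mf; have [e eP] := esum_countable cI.
rewrite (_ : (fun _ => _) =
    fun x => \sum_(n <oo | n \in xpredT) oapp (f^~ x) 0 (e n)); last first.
  by apply/funext => x; rewrite eP.
apply: ge0_emeasurable_sum => [n x _ _|n _]; case: (e n) => //=.
Qed.

Lemma ge0_integral_esum (f : I -> T -> \bar R) : countable [set: I] ->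
  (forall i x, 0 <= f i x) -> (forall i, measurable_fun setT (f i)) ->
  \int[mu]_x (\esum_(i in [set: I]) f i x) =
  \esum_(i in [set: I]) \int[mu]_x f i x.
Proof.
move=> cI f0 mf; have [e eP] := esum_countable cI.
rewrite eP; last by move=> i; exact: integral_ge0.
under eq_integral do rewrite eP//.
rewrite integral_nneseries//.
- by apply: eq_eseriesr => n _; case: (e n) => //=; rewrite integral0.
- by move=> n; case: (e n) => //=; exact: measurable_cst.
- by move=> n x _; case: (e n) => /=.
Qed.

End CountableSums.

(** * Orbit sums and the mass transport principle *)

Section OrbitSums.
Context {R : realType} d (T : measurableType d) (mu : {measure set T -> \bar R}).
Context (G : groupType) (a : G -> T -> T).
Hypotheses (cG : countable [set: G]) (mp : measure_preserving_action mu a).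

Let a1 x : a 1%g x = x. Proof. by case: mp => -[]. Qed.
Let aM g h x : a (g * h)%g x = a g (a h x). Proof. by case: mp => -[]. Qed.
Let ma g : measurable_fun setT (a g). Proof. by case: mp. Qed.

Lemma actK g : cancel (a g) (a g^-1%g).
Proof. by move=> x; rewrite -aM mulVg a1. Qed.

Lemma actVK g : cancel (a g^-1%g) (a g).
Proof. by move=> x; rewrite -aM mulgV a1. Qed.

Lemma measurable_preimage_act g (A : set T) :
  measurable A -> measurable (a g @^-1` A).
Proof. by move=> mA; rewrite -[_ @^-1` _]setTI; exact: ma. Qed.

Lemma ge0_integral_act g (f : T -> \bar R) :
  measurable_fun setT f -> (forall x, 0 <= f x) ->
  \int[mu]_x f (a g x) = \int[mu]_x f x.
Proof.
move=> mf f0; have := @ge0_integral_pushforward _ _ _ _ _ _ (ma g) mu setT f.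
rewrite preimage_setT => <-//.
by apply: eq_measure_integral => A mA _; case: mp => _ _ /(_ g A mA).
Qed.

Definition orbit_sum (u : T -> R) x := \esum_(g in [set: G]) (u (a g x))%:E.

Lemma orbit_sum_act u g x : orbit_sum u (a g x) = orbit_sum u x.
Proof.
rewrite /orbit_sum [RHS](reindex_esum [set: G] _ (fun h => h * g)%g).
  by apply: eq_esum => h _; rewrite aM.
split=> //; first by move=> h k _ _ /mulIg.
by move=> h _; exists (h * g^-1)%g => //; rewrite mulgVK.
Qed.

Lemma measurable_orbit_sum (u : T -> R) : (forall x, (0 <= u x)%R) ->
  measurable_fun setT u -> measurable_fun setT (orbit_sum u).
Proof.
move=> u0 mu'; apply: measurable_esum => // [g x|g]; first by rewrite lee_fin.
by apply/measurable_EFinP; apply: measurableT_comp.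
Qed.

Lemma orbit_sum_ge0 (u : T -> R) x : (forall x, (0 <= u x)%R) -> 0 <= orbit_sum u x.
Proof. by move=> u0; apply: esum_ge0 => g _; rewrite lee_fin. Qed.

(** Both sides expand into sums over [g] of integrals of a product of one function at [x] with the
    other at [a g x]. Invariance of [mu] under [g] matches the term of [g] on one side with that of
    its inverse on the other. *)
Lemma mass_transport (u v : T -> R) :
  (forall x, (0 <= u x)%R) -> (forall x, (0 <= v x)%R) ->
  measurable_fun setT u -> measurable_fun setT v ->
  \int[mu]_x ((u x)%:E * orbit_sum v x) = \int[mu]_x ((v x)%:E * orbit_sum u x).
Proof.
move=> u0 v0 mu' mv.
have E (f h : T -> R) : (forall x, (0 <= f x)%R) -> (forall x, (0 <= h x)%R) ->
    measurable_fun setT f -> measurable_fun setT h ->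
    \int[mu]_x ((f x)%:E * orbit_sum h x) =
    \esum_(g in [set: G]) \int[mu]_x (f x * h (a g x))%:E.
  move=> f0 h0 mf mh; rewrite -ge0_integral_esum//.
  - apply: eq_integral => x _; rewrite /orbit_sum -ge0_esumZl//.
    by move=> g; rewrite lee_fin.
  - by move=> g x; rewrite lee_fin mulr_ge0.
  - move=> g; apply/measurable_EFinP; apply: measurable_funM => //.
    exact: measurableT_comp.
rewrite !E// (reindex_esum [set: G] _ (fun g => g^-1)%g); last first.
  split=> //; first by move=> g h _ _ /invg_inj.
  by move=> g _; exists g^-1%g => //; rewrite invgK.
apply: eq_esum => g _; rewrite -(ge0_integral_act g).
- by apply: eq_integral => x _; rewrite actK mulrC.
- apply/measurable_EFinP; apply: measurable_funM => //.
  exact: measurableT_comp.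
- by move=> x; rewrite lee_fin mulr_ge0.
Qed.

End OrbitSums.

(** * Finiteness of return counts and concentration of orbit sums *)

Section Concentration.
Context {R : realType} d (T : measurableType d) (mu : {measure set T -> \bar R}).
Context (G : groupType) (a : G -> T -> T) (X Y : set T).
Hypotheses (cG : countable [set: G]) (mp : measure_preserving_action mu a).
Hypotheses (mX : measurable X) (finX : mu X < +oo) (mY : measurable Y).
Hypothesis Yfree : forall g x, Y x -> Y (a g x) -> g = 1%g.

Let act1 x : a 1%g x = x. Proof. by case: mp => -[]. Qed.
Let actM g h x : a (g * h)%g x = a g (a h x). Proof. by case: mp => -[]. Qed.

Let indic_ge0 (A : set T) x : (0 <= \1_A x :> R)%R.
Proof. by rewrite indicE ler0n. Qed.
#[local] Hint Resolve indic_ge0 : core.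

(** Orbit sums are constant on orbits, so the sum may be based at a point of [Y], where [Yfree]
    leaves only the identity term. *)
Lemma orbit_sum_domain x : (exists g, Y (a g x)) ->
  orbit_sum a (\1_Y : T -> R) x = 1.
Proof.
move=> [g Ygx]; rewrite -(orbit_sum_act mp _ g x).
rewrite /orbit_sum (esumID [set 1%g]); last by move=> h _; rewrite lee_fin.
rewrite setTI esum_set1 ?lee_fin// act1 indicE (mem_set Ygx) esum1 ?adde0//.
move=> h [_ /= h1]; rewrite indicE memNset//.
by move=> /(Yfree Ygx).
Qed.

(** Mass transport against the indicator of [Y]: an integral over the space becomes an integral over
    [Y] of orbit sums. *)
Lemma integral_domain (v : T -> R) :
  (forall x, (0 <= v x)%R) -> measurable_fun setT v ->
  (forall x, v x != 0%R -> exists g, Y (a g x)) ->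
  \int[mu]_x ((\1_Y x)%:E * orbit_sum a v x) = \int[mu]_x (v x)%:E.
Proof.
move=> v0 mv vY; rewrite (mass_transport cG mp)//.
apply: eq_integral => x _; have [->|vx] := eqVneq (v x) 0%R.
  by rewrite mul0e.
by rewrite orbit_sum_domain ?mule1//; exact: vY.
Qed.

Hypothesis XY : forall x, X x -> exists g, Y (a g x).

Let F := orbit_sum a (\1_X : T -> R).

Let mF : measurable_fun setT F.
Proof. by apply: (measurable_orbit_sum cG mp) => //; exact: measurable_indic. Qed.

Let F_ge0 x : 0 <= F x. Proof. exact: orbit_sum_ge0. Qed.

(* If [Z] is the set where [F] is infinite, mass transport between [Y] and
   [X `&` Z] gives [mu (X `&` Z) = +oo * mu (Y `&` Z)]. *)
Lemma orbit_sum_finite : mu (X `&` [set x | F x = +oo]) = 0.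
Proof.
set Z := [set x | F x = +oo].
have mZ : measurable Z.
  by rewrite -[Z]setTI; exact: (mF measurableT (emeasurable_set1 +oo)).
have Zact g x : Z (a g x) <-> Z x by rewrite /Z /= /F (orbit_sum_act mp).
have mXZ : measurable (X `&` Z) by exact: measurableI.
have mYZ : measurable (Y `&` Z) by exact: measurableI.
have : \int[mu]_x ((\1_Y x)%:E * orbit_sum a (\1_(X `&` Z) : T -> R) x) =
       mu (X `&` Z).
  rewrite integral_domain//; first by rewrite integral_indic// setIT.
  move=> x; rewrite indicE; case: (boolP (x \in X `&` Z)) => [|_ /eqP//].
  by rewrite inE => -[Xx _] _; exact: XY.
have -> : \int[mu]_x ((\1_Y x)%:E * orbit_sum a (\1_(X `&` Z) : T -> R) x) =
          +oo * mu (Y `&` Z).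
  rewrite -[Y `&` Z in RHS]setIT -integral_indic// -ge0_integralZl//.
  - apply: eq_integral => x _; have [Zx|Zx] := pselect (Z x).
      rewrite [orbit_sum _ _ _](_ : _ = F x); last first.
        apply: eq_esum => g _; rewrite !indicE in_setI andbC.
        by rewrite (mem_set ((Zact g x).2 Zx)).
      by rewrite Zx !indicE in_setI (mem_set Zx) andbT muleC.
    rewrite [orbit_sum _ _ _]esum1 ?mule0; last first.
      by move=> g _; rewrite indicE memNset// => -[_ /Zact].
    by rewrite indicE memNset ?mule0// => -[].
  - by apply/measurable_EFinP; exact: measurable_indic.
have [->|YZ0] := eqVneq (mu (Y `&` Z)) 0; first by rewrite mule0 => <-.
rewrite gt0_mulye ?lt0e ?YZ0//= => XZoo.
have : mu (X `&` Z) <= mu X by apply: le_measure; rewrite ?inE//; exact: subIsetl.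
by rewrite -XZoo leye_eq => /eqP Xoo; have := finX; rewrite Xoo.
Qed.

(** Inside [X], of finite measure, the sets where [F] exceeds n + 1 decrease to the null set where
    [F] is infinite; continuity from above concludes. *)
Lemma orbit_sum_tight (e : R) : (0 < e)%R ->
  exists2 K : R, (0 < K)%R & mu (X `&` [set x | K%:E < F x]) <= e%:E.
Proof.
move=> e0; pose A n := X `&` [set x | n.+1%:R%:E < F x].
have mA n : measurable (A n).
  apply: measurableI => //; rewrite -[X in measurable X]setTI.
  exact: emeasurable_fun_o_infty.
have AE : \bigcap_n A n = X `&` [set x | F x = +oo].
  apply/seteqP; split => [x AX|x [Xx /= Fx] n _]; last by split=> //=; rewrite Fx ltry.
  split; first by have [] := AX 0%N.
  apply: eq_infty => r.
  have [_ /= /ltW] := AX (Num.truncn `|r|) I; apply: le_trans; rewrite lee_fin.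
  by rewrite (le_trans (ler_norm r))// ltW// truncnS_gt.
apply: contrapT => noK.
have Age n : e%:E <= mu (A n).
  rewrite leNgt; apply/negP => /ltW Ae; apply: noK.
  by exists n.+1%:R.
have : mu \o A @ \oo --> mu (\bigcap_n A n).
  apply: nonincreasing_cvg_mu => //.
  - by apply: le_lt_trans finX; apply: le_measure; rewrite ?inE//; exact: subIsetl.
  - exact: bigcap_measurableType.
  - move=> m n mn; apply/subsetPset => x [Xx /= Fx]; split => //=.
    by apply: le_lt_trans Fx; rewrite lee_fin ler_nat.
rewrite AE orbit_sum_finite => cvgA.
have : e%:E <= limn (mu \o A) by apply: lime_ge; [exact: cvgP cvgA|exact: nearW].
by rewrite (cvg_lim _ cvgA)// lee_fin leNgt e0.
Qed.

(** Tightness makes the part of [X] where [F] exceeds [K] at most a quarter of [X]. On the rest,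
    [A], mass transport trades the orbit sum of [u] for that of the indicator of [A], which is at
    most [K]; Markov's inequality at level 4 K r then loses another quarter. *)
Lemma orbit_sum_concentration : 0 < mu X -> exists2 C : R, (0 < C)%R &
  forall (u : T -> R) (r : R), (0 < r)%R ->
    (forall x, (0 <= u x)%R) -> measurable_fun setT u ->
    \int[mu]_x (u x)%:E <= r%:E * mu X ->
    mu (X `&` [set x | (C * r)%:E < orbit_sum a u x]) <= 2^-1%:E * mu X.
Proof.
move=> X0; have Xfin : mu X \is a fin_num by rewrite ge0_fin_numE.
have m0 : (0 < fine (mu X))%R by rewrite fine_gt0// X0.
have [|K K0 XK] := @orbit_sum_tight (fine (mu X) / 4); first by rewrite divr_gt0.
exists (4 * K)%R => [|u r r0 u0 mu' ur]; first by rewrite mulr_gt0.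
set B := [set x | _ < orbit_sum a u x].
have mB : measurable B.
  rewrite -[B]setTI; apply: emeasurable_fun_o_infty => //.
  exact: (measurable_orbit_sum cG mp).
pose A := X `&` [set x | F x <= K%:E].
have mA : measurable A.
  apply: measurableI => //; rewrite -[X in measurable X]setTI.
  exact: emeasurable_fun_infty_c.
(* This holds at every point: if [F x] exceeds [K], then so does [F] along the whole orbit, which
   therefore misses [A]. *)
have sumA x : orbit_sum a (\1_A : T -> R) x <= K%:E.
  have [Fx|Fx] := leP (F x) K%:E.
    apply: le_trans Fx; apply: le_esum => g _; rewrite lee_fin !indicE ler_nat.
    by rewrite in_setI; case: (_ \in X) => //=; case: (_ \in _).
  rewrite [orbit_sum _ _ _]esum1 ?lee_fin ?ltW// => g _.
  by rewrite indicE memNset// => -[_]; rewrite /= /F (orbit_sum_act mp) leNgt Fx.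
have intA : (4 * K * r)%:E * mu (A `&` B) <= (K * r)%:E * mu X.
  rewrite -[A `&` B]setIT -integral_indic//; last exact: measurableI.
  rewrite -ge0_integralZl_EFin//; last 2 first.
  - by apply/measurable_EFinP; apply: measurable_indic; exact: measurableI.
  - by rewrite !mulr_ge0// ltW.
  apply: (@le_trans _ _ (\int[mu]_x ((\1_A x)%:E * orbit_sum a u x))).
    apply: ge0_le_integral => //.
    - by move=> x _; rewrite -EFinM lee_fin !mulr_ge0// ltW.
    - apply/measurable_EFinP; apply: measurable_funM => //.
      by apply: measurable_indic; exact: measurableI.
    - apply: emeasurable_funM; last exact: (measurable_orbit_sum cG mp).
      by apply/measurable_EFinP; exact: measurable_indic.
    - move=> x _; rewrite !indicE in_setI; case: (x \in A) => /=; last first.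
        by rewrite mule0 mul0e.
      case: (boolP (x \in B)) => [|_]; rewrite /= mul1e.
        by rewrite inE mule1 => /ltW.
      by rewrite mule0 orbit_sum_ge0.
  rewrite (mass_transport cG mp)//.
  apply: (@le_trans _ _ (K%:E * \int[mu]_x (u x)%:E)).
    rewrite -ge0_integralZl_EFin//; last 3 first.
    - by move=> x _; rewrite lee_fin.
    - exact/measurable_EFinP.
    - exact: ltW.
    apply: ge0_le_integral => //.
    - by move=> x _; rewrite mule_ge0// ?lee_fin// orbit_sum_ge0.
    - apply: emeasurable_funM; first exact/measurable_EFinP.
      by apply: (measurable_orbit_sum cG mp) => //; exact: measurable_indic.
    - by apply/measurable_EFinP; exact: measurable_funM.
    - by move=> x _; rewrite muleC lee_wpmul2r// lee_fin.
  by rewrite EFinM -muleA lee_wpmul2l// lee_fin ltW.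
have ABfin : mu (A `&` B) \is a fin_num.
  rewrite ge0_fin_numE//; apply: le_lt_trans finX.
  by apply: le_measure; rewrite ?inE//; [exact: measurableI|move=> x [[]]].
have {}intA : mu (A `&` B) <= (fine (mu X) / 4)%:E.
  move: intA; rewrite -(fineK Xfin) -(fineK ABfin) -!EFinM !lee_fin.
  by rewrite -mulrA -mulrA ler_pdivlMr// mulrC -[leLHS]mulrA ler_pM2l ?mulr_gt0.
have -> : 2^-1%:E * mu X = (fine (mu X) / 4)%:E + (fine (mu X) / 4)%:E.
  by rewrite -{1}(fineK Xfin) -EFinM -EFinD; congr EFin; field.
apply: le_trans (leeD XK intA); apply: le_trans (measureU2 _ _ _); last 2 first.
- apply: measurableI => //; rewrite -[X in measurable X]setTI.
  exact: emeasurable_fun_o_infty.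
- exact: measurableI.
apply: le_measure; rewrite ?inE//; first exact: measurableI.
  apply: measurableU; last exact: measurableI.
  apply: measurableI => //; rewrite -[X in measurable X]setTI.
  exact: emeasurable_fun_o_infty.
move=> x [Xx Bx]; have [Fx|Fx] := leP (F x) K%:E; first by right.
by left.
Qed.

End Concentration.

(** * Measurable selection from countably many sets *)

Section MeasurableSelection.
Context d (T : measurableType d).

Lemma measurable_fun_nat (f : T -> nat) :
  (forall n, measurable [set x | f x = n]) -> measurable_fun setT f.
Proof.
move=> mf _ B _; rewrite setTI (_ : _ @^-1` B = \bigcup_(n in B) [set x | f x = n]).
  by apply: bigcup_measurable => n _; exact: mf.
by apply/seteqP; split => [x Bx|x [n Bn /= ->]] //; exists (f x).
Qed.

Lemma measurable_first_index (A : nat -> set T) :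
  (forall n, measurable (A n)) -> exists2 f : T -> nat, measurable_fun setT f &
    forall x n, A n x -> A (f x) x /\ (f x <= n)%N.
Proof.
move=> mA.
pose f x := if pselect (exists n, `[< A n x >]) is left ex then ex_minn ex else 0%N.
have fP x n : A n x -> A (f x) x /\ (f x <= n)%N.
  rewrite /f => Anx; case: pselect => [ex|[]]; last by exists n; apply/asboolP.
  by case: ex_minnP => m /asboolP Am mP; split => //; apply: mP; apply/asboolP.
exists f => //; apply: measurable_fun_nat => n.
pose B n := A n `\` \bigcup_(i in `I_n) A i.
have mB : measurable (B n).
  by apply: measurableD => //; apply: bigcup_measurable => i _; exact: mA.
have mC : measurable (~` \bigcup_i A i).
  by apply: measurableC; apply: bigcup_measurable => i _; exact: mA.
(* Points outside every [A i] receive the default index 0, hence the extra piece in the fibre over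
   0. *)
have BE : [set x | f x = n] = B n `|` (if n is 0%N then ~` \bigcup_i A i else set0).
  apply/seteqP; split => [x /= fxn|x [[An nA]|]].
  - have [[n0 Ax]|nA] := pselect (exists n, A n x).
      have [+ _] := fP _ _ Ax; rewrite fxn => An; left; split => // -[i /= ilt Aix].
      by have := (fP _ _ Aix).2; rewrite fxn leqNgt ilt.
    have f0 : f x = 0%N.
      rewrite /f; case: pselect => // ex; have [i /asboolP Ai] := ex.
      by case: nA; exists i.
    by right; rewrite -fxn f0 => -[i _ Ai]; apply: nA; exists i.
  - have [Afx fxn] := fP _ _ An; apply/eqP; rewrite eqn_leq fxn /= leqNgt.
    by apply/negP => fn; apply: nA; exists (f x).
  - case: n {B mB} => // nA /=; rewrite /f; case: pselect => // ex.
    by have [i /asboolP Ai] := ex; case: nA; exists i.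
by rewrite BE; apply: measurableU => //; case: n {B mB BE} => [|n] //; exact: measurable0.
Qed.

(** Two selections in a row: first the least size [k x], then the first code of an element of that
    size whose set contains [x]. It serves to pick shortest words measurably. *)
Lemma measurable_least_index (W : countType) (w0 : W) (sz : W -> nat)
    (A : W -> set T) : (forall w, measurable (A w)) ->
  exists2 f : T -> W, (forall B, measurable (f @^-1` B)) &
    forall x w, A w x -> A (f x) x /\ (sz (f x) <= sz w)%N.
Proof.
move=> mA; have cW (P : set W) : countable P by exact: countableP.
have [k mk kP] : exists2 k : T -> nat, measurable_fun setT k &
    forall x n, (\bigcup_(w in [set w | sz w = n]) A w) x ->
      (\bigcup_(w in [set w | sz w = k x]) A w) x /\ (k x <= n)%N.
  apply: (@measurable_first_index
    (fun n => \bigcup_(w in [set w | sz w = n]) A w)) => n.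
  rewrite bigcup_mkcond; apply: countable_bigcupT_measurable => // w.
  by case: ifP => // _; exact: measurable0.
pose E m : set T :=
  if @pickle_inv W m is Some w then A w `&` [set x | k x = sz w] else set0.
have mE m : measurable (E m).
  rewrite /E; case: pickle_inv => [w|]; last exact: measurable0.
  apply: measurableI => //; rewrite -[X in measurable X]setTI.
  exact: (mk measurableT [set sz w]).
have [t mt tP] := measurable_first_index mE.
exists (fun x => odflt w0 (@pickle_inv W (t x))).
  move=> B; rewrite -[X in measurable X]setTI.
  exact: (mt measurableT [set m | B (odflt w0 (@pickle_inv W m))]).
move=> x w Aw.
have [[w' /= sw' Aw'] kw] := kP x (sz w) (ex_intro2 _ _ w erefl Aw).
have [|+ _] := tP x (@choice.pickle W w'); first by rewrite /E pickleK_inv.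
by rewrite /E; case: pickle_inv => // v [Av /= kv]; split => //; rewrite -kv.
Qed.

End MeasurableSelection.

(** * Norms of finitely supported functions and the cost of translations *)

Lemma esum_finite_support {R : realType} {I : choiceType} (f : I -> R) :
  (forall i, (0 <= f i)%R) -> finite_set [set i | f i != 0%R] ->
  \esum_(i in [set: I]) (f i)%:E = (\sum_(i \in [set: I]) f i)%:E.
Proof.
move=> f0 fin; rewrite -(fsbig_widen [set i | f i != 0%R])//; last first.
  by move=> i [_ /= /negP]; rewrite negbK => /eqP.
rewrite -fsumEFin// -esum_fset//; last by move=> i _; rewrite lee_fin.
rewrite [RHS]esum_mkcond; apply: eq_esum => i _.
by case: ifPn => //; rewrite notin_setE /= => /negP; rewrite negbK => /eqP ->.
Qed.

Section Norms.
Context {R : realType} {G : groupType}.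
Implicit Type (f : G -> R).

Lemma norm1_esum f : finite_set [set g | f g != 0%R] ->
  \esum_(g in [set: G]) `|f g|%:E = (norm1 f)%:E.
Proof.
move=> fin; apply: esum_finite_support => //.
rewrite (_ : [set _ | _] = [set g | f g != 0%R])//.
by apply: eq_set => g; rewrite normr_eq0.
Qed.

Lemma grad_norm1_esum (S : {fset G}) f : finite_set [set g | f g != 0%R] ->
  \esum_(g in [set: G]) (\sum_(s <- S) `|f (s * g)%g - f g|)%:E =
  (grad_norm1 S f)%:E.
Proof.
move=> fin; apply: esum_finite_support => [g|]; first exact: sumr_ge0.
apply: (@sub_finite_set _ _ ([set g | f g != 0%R] `|`
  \bigcup_(s in [set` S]) (fun g => s * g)%g @^-1` [set g | f g != 0%R])).
  move=> g /= /eqP dg; apply: contrapT => /not_orP[/negP]; rewrite negbK => /eqP fg.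
  move=> nS; apply: dg; rewrite big_seq big1// => s sS.
  rewrite fg subr0; apply/eqP; rewrite normr_eq0; apply: contrapT => /negP fsg.
  by apply: nS; exists s.
rewrite finite_setU; split => //; apply: bigcup_finite => // s _.
apply: finite_preimage => // g h _ _; exact: mulgI.
Qed.

(** Telescoping along the word: the increment from [g] to [s^-1 * g] is one of the terms of the
    gradient because [S] is symmetric, and the remaining increment is the induction hypothesis
    reindexed by [s^-1]. *)
Lemma esum_translate_le (S : {fset G}) f (w : seq G) :
  (forall s, s \in S -> (s^-1)%g \in S) -> {subset w <= S} ->
  \esum_(g in [set: G]) `|f ((\prod_(s <- w) s)^-1 * g)%g - f g|%:E <=
  (size w)%:R%:E *
    \esum_(g in [set: G]) (\sum_(s <- S) `|f (s * g)%g - f g|)%:E.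
Proof.
move=> Sinv; elim: w => [_|s w IH wS].
  rewrite mul0e esum1// => g _.
  by rewrite big_nil invg1 mul1g subrr normr0.
have sS : s \in S by apply: wS; rewrite mem_head.
have {}IH := IH (fun t tw => wS t (mem_behead (s := s :: w) tw)).
set D := \esum_(g in _) _ in IH *.
rewrite /= -addn1 natrD EFinD ge0_muleDl ?lee_fin// mul1e.
apply: (@le_trans _ _ (\esum_(g in [set: G])
   (`|f ((\prod_(t <- w) t)^-1 * (s^-1 * g))%g - f (s^-1 * g)%g|%:E +
    `|f (s^-1 * g)%g - f g|%:E))).
  apply: le_esum => g _; rewrite -EFinD lee_fin big_cons invgM -mulgA.
  by rewrite (le_trans _ (ler_normD _ _))// addrA subrK.
rewrite esumD// ?leeD//; last first.
  apply: le_esum => g _; rewrite lee_fin (big_fsetD1 _ (Sinv _ sS))/=.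
  by rewrite lerDl sumr_ge0.
apply: le_trans IH; rewrite [leRHS](reindex_esum [set: G] _ (fun g => s^-1 * g)%g)//.
split=> //; first by move=> g h _ _ /mulgI.
by move=> g _; exists (s * g)%g => //; rewrite mulKg.
Qed.

Lemma esum_translate_le2 f (u : G) :
  \esum_(g in [set: G]) `|f (u * g)%g - f g|%:E <=
  2%:E * \esum_(g in [set: G]) `|f g|%:E.
Proof.
apply: (@le_trans _ _ (\esum_(g in [set: G]) (`|f (u * g)%g|%:E + `|f g|%:E))).
  by apply: le_esum => g _; rewrite -EFinD lee_fin ler_normB.
rewrite esumD// (_ : 2%:E = 1%:E + 1%:E :> \bar R); last by rewrite -EFinD.
rewrite ge0_muleDl ?lee_fin// mul1e leeD//.
rewrite [leRHS](reindex_esum [set: G] _ (fun g => u * g)%g)//.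
split=> //; first by move=> g h _ _ /mulgI.
by move=> g _; exists (u^-1 * g)%g => //; rewrite mulVKg.
Qed.

End Norms.

(** * Lifting functions on the group to the coupling space *)

Section Lift.
Context {R : realType} d (T : measurableType d) (mu : {measure set T -> \bar R}).
Context (L : groupType) (a : L -> T -> T) (X : set T).
Hypotheses (cL : countable [set: L]) (mp : measure_preserving_action mu a).
Hypothesis (mX : measurable X).
Context (f : L -> R).
Hypotheses (f0 : forall l, (0 <= f l)%R) (finf : finite_set [set l | f l != 0%R]).

(* The action of [L] need not be free: the value at a point [x] of [X] is the
   sum of [f] over the stabilizer of [x]. *)
Definition lift_fun (x : T) : R := (\sum_(l \in [set: L]) (f l * \1_X (a l x)))%R.

Let ma l : measurable_fun setT (a l). Proof. by case: mp. Qed.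

Let mXa l : measurable_fun setT (fun x => \1_X (a l x) : R).
Proof. by apply: measurableT_comp => //; exact: measurable_indic. Qed.

Let indic_ge0 (A : set T) x : (0 <= \1_A x :> R)%R.
Proof. by rewrite indicE ler0n. Qed.
#[local] Hint Resolve indic_ge0 : core.

Lemma lift_fun_esum x :
  (lift_fun x)%:E = \esum_(l in [set: L]) (f l * \1_X (a l x))%:E.
Proof.
rewrite esum_finite_support// => [l|]; first by rewrite mulr_ge0.
by apply: sub_finite_set finf => l /=; apply: contra => /eqP ->; rewrite mul0r.
Qed.

Lemma lift_fun_ge0 x : (0 <= lift_fun x)%R.
Proof.
rewrite -lee_fin lift_fun_esum.
by apply: esum_ge0 => l _; rewrite lee_fin mulr_ge0.
Qed.

Lemma measurable_lift_fun : measurable_fun setT lift_fun.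
Proof.
apply/measurable_EFinP.
rewrite (_ : _ \o _ = fun x => \esum_(l in [set: L]) (f l * \1_X (a l x))%:E).
  apply: measurable_esum => // [l x|l]; first by rewrite lee_fin mulr_ge0.
  by apply/measurable_EFinP; apply: measurable_funM.
by apply/funext => x /=; rewrite lift_fun_esum.
Qed.

(** Invariance under [l] brings the term of [l] back to [X]. With [v] constant this computes the
    total mass of the lift, with [v] an indicator the mass kept on a set. *)
Lemma integral_lift_fun (v : T -> R) : (forall x, (0 <= v x)%R) ->
  measurable_fun setT v ->
  \int[mu]_x (lift_fun x * v x)%:E =
  \esum_(l in [set: L]) ((f l)%:E * \int[mu]_x (\1_X x * v (a l^-1%g x))%:E).
Proof.
move=> v0 mv; transitivity
    (\int[mu]_x (\esum_(l in [set: L]) ((f l)%:E * (\1_X (a l x) * v x)%:E))).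
  apply: eq_integral => x _; rewrite EFinM muleC lift_fun_esum -ge0_esumZl//.
    by apply: eq_esum => l _; rewrite -!EFinM; congr EFin; ring.
  by move=> l; rewrite lee_fin mulr_ge0.
rewrite ge0_integral_esum//.
- apply: eq_esum => l _; rewrite ge0_integralZl_EFin//.
  + congr (_ * _); rewrite -[RHS](ge0_integral_act mp l).
    * by apply: eq_integral => x _; rewrite (actK mp).
    * apply/measurable_EFinP; apply: measurable_funM; first exact: measurable_indic.
      exact: measurableT_comp.
    * by move=> x; rewrite lee_fin mulr_ge0.
  + by move=> x _; rewrite lee_fin mulr_ge0.
  + by apply/measurable_EFinP; apply: measurable_funM.
- by move=> l x; rewrite mule_ge0// lee_fin// mulr_ge0.
- move=> l; apply: measurable_funeM.
  by apply/measurable_EFinP; apply: measurable_funM.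
Qed.

Lemma integral_lift_funT : mu X < +oo ->
  \int[mu]_x (lift_fun x)%:E = (norm1 f)%:E * mu X.
Proof.
move=> finX; have Xfin : mu X \is a fin_num by rewrite ge0_fin_numE.
under eq_integral do rewrite -[lift_fun _]mulr1.
rewrite (integral_lift_fun (v := cst 1%R))//.
rewrite -norm1_esum// muleC -(fineK Xfin) -ge0_esumZl ?fine_ge0//.
apply: eq_esum => l _; rewrite (fineK Xfin) muleC ger0_norm//; congr (_ * _).
under eq_integral do rewrite /= mulr1.
by rewrite integral_indic// setIT.
Qed.

Context (G : groupType) (b : G -> T -> T).
Hypothesis mpb : measure_preserving_action mu b.
Hypothesis commute : forall g l x, b g (a l x) = a l (b g x).
Hypothesis Xuniq : forall l x, X x -> X (a l x) -> a l x = x.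
Hypothesis Xcover : forall g x, X x -> exists l, X (a l (b g x)).

(* All the points [a l x] in [X] coincide, so a single cocycle value [t y]
   is met along the orbit of [x]; reindexing by it turns the value of the lift
   at [b g x] into that of a left translate of [f] at [x]. *)
Lemma lift_fun_displacement (g : G) (t : T -> L) x :
  (forall y, X y -> X (a (t y) (b g y))) ->
  `|lift_fun (b g x) - lift_fun x|%:E <=
  \esum_(l in [set: L])
     (\1_X (a l x) * `|f (t (a l x) * l)%g - f l|)%:E.
Proof.
move=> tX; have aM h k y : a (h * k)%g y = a h (a k y) by case: mp => -[].
set D := \esum_(l in _) _.
(* If the orbit of [x] misses [X], then so does that of [b g x], by [Xcover] for the inverse of [g];
   both values of the lift vanish. *)
have [[l0 Xl0]|nX] := pselect (exists l, X (a l x)); last first.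
  have z l : \1_X (a l x) = 0%R :> R.
    by rewrite indicE memNset// => Xl; apply: nX; exists l.
  have zg l : \1_X (a l (b g x)) = 0%R :> R.
    rewrite indicE memNset// -commute => /(Xcover g^-1%g)[k].
    by rewrite (actK mpb) -aM => Xk; apply: nX; exists (k * l)%g.
  rewrite /lift_fun [X in (X - _)%R]fsbig1 => [|l _]; last by rewrite zg mulr0.
  rewrite fsbig1 => [|l _]; last by rewrite z mulr0.
  by rewrite subrr normr0 esum_ge0// => l _; rewrite lee_fin mulr_ge0.
set y := a l0 x in Xl0; pose u := t y.
have XE l : X (a l x) -> a l x = y.
  rewrite -[l](mulgVK l0) aM => Xl; exact: Xuniq.
have XuE l : X (a (u * l)%g (b g x)) <-> X (a l x).
  split=> [Xul|Xl]; last by rewrite aM -commute (XE _ Xl); exact: tX.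
  suff -> : a l x = y by [].
  have Xuy := tX y Xl0.
  have : a (u * l)%g (b g x) = a u (b g y).
    rewrite -[RHS](Xuniq (l := (u * l * (u * l0)^-1)%g))//.
      by rewrite /y commute -!aM -mulgA mulgVK.
    by move: Xul; rewrite /y commute -!aM -mulgA mulgVK.
  by rewrite aM => /(can_inj (actK mp u)); rewrite -commute => /(can_inj (actK mpb g)).
have gE : (lift_fun (b g x))%:E =
    \esum_(l in [set: L]) (\1_X (a l x) * f (u * l)%g)%:E.
  rewrite lift_fun_esum (reindex_esum [set: L] _ (fun l => u * l)%g).
    apply: eq_esum => l _; rewrite mulrC !indicE.
    by congr (((nat_of_bool _)%:R * _)%:E); apply/idP/idP; rewrite !inE => /XuE.
  split=> //; first by move=> h k _ _ /mulgI.
  by move=> h _; exists (u^-1 * h)%g => //; rewrite mulVKg.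
have DE : D = \esum_(l in [set: L]) (\1_X (a l x) * `|f (u * l)%g - f l|)%:E.
  apply: eq_esum => l _; rewrite indicE; case: (boolP (a l x \in X)) => [|_].
    by rewrite inE => /XE ->.
  by rewrite !mul0r.
(* Two one-sided estimates avoid subtracting extended reals; the case where [D] is infinite is
   trivial. *)
have le1 : (lift_fun (b g x))%:E <= (lift_fun x)%:E + D.
  rewrite gE lift_fun_esum DE -esumD; try by move=> l _; rewrite lee_fin mulr_ge0.
  apply: le_esum => l _; rewrite -EFinD lee_fin [(f l * _)%R]mulrC -mulrDr ler_wpM2l//.
  by rewrite addrC -lerBlDr ler_norm.
have le2 : (lift_fun x)%:E <= (lift_fun (b g x))%:E + D.
  rewrite gE lift_fun_esum DE -esumD; try by move=> l _; rewrite lee_fin mulr_ge0.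
  apply: le_esum => l _; rewrite -EFinD lee_fin [(f l * _)%R]mulrC -mulrDr ler_wpM2l//.
  by rewrite addrC -lerBlDr distrC ler_norm.
have : 0 <= D by apply: esum_ge0 => l _; rewrite lee_fin mulr_ge0.
case: D DE le1 le2 => [r _|_ _ _ _|//]; last exact: leey.
by rewrite -!EFinD !lee_fin ler_norml => le1 le2 _; apply/andP; split; lra.
Qed.

(** After integration of the pointwise bound, translating the term of [l] by [l] gathers all terms
    over [X], with the cocycle value taken at the point itself. *)
Lemma integral_displacement (g : G) (t : T -> L) :
  (forall B, measurable (t @^-1` B)) ->
  (forall y, X y -> X (a (t y) (b g y))) ->
  \int[mu]_x `|lift_fun (b g x) - lift_fun x|%:E <=
  \int[mu]_x ((\1_X x)%:E * \esum_(l in [set: L]) `|f (t x * l)%g - f l|%:E).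
Proof.
move=> mt tX.
have mh l : measurable_fun setT (fun x => `|f (t x * l)%g - f l|%R).
  move=> _ B mB; rewrite setTI.
  exact: (mt [set k | B `|f (k * l)%g - f l|%R]).
have mXh l : measurable_fun setT (fun x => (\1_X x * `|f (t x * l)%g - f l|)%:E).
  by apply/measurable_EFinP; apply: measurable_funM => //; exact: measurable_indic.
apply: (@le_trans _ _ (\int[mu]_x (\esum_(l in [set: L])
     (\1_X (a l x) * `|f (t (a l x) * l)%g - f l|)%:E))).
  apply: ge0_le_integral => //.
  - apply/measurable_EFinP; apply: measurableT_comp => //; apply: measurable_funB.
      apply: measurableT_comp; first exact: measurable_lift_fun.
      by case: mpb.
    exact: measurable_lift_fun.
  - apply: measurable_esum => // l; exact: (measurableT_comp (mXh l) (ma l)).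
  - by move=> x _; exact: lift_fun_displacement.
rewrite ge0_integral_esum//; last first.
  by move=> l; exact: (measurableT_comp (mXh l) (ma l)).
rewrite (_ : \esum_(l in _) _ = \esum_(l in [set: L])
    \int[mu]_x (\1_X x * `|f (t x * l)%g - f l|)%:E); last first.
  by apply: eq_esum => l _; rewrite -[RHS](ge0_integral_act mp l)//.
rewrite -ge0_integral_esum//.
rewrite le_eqVlt; apply/orP; left; apply/eqP; apply: eq_integral => x _.
by rewrite -ge0_esumZl.
Qed.

End Lift.

(** * Elementary estimates on norms, supports and [phi] *)

Lemma norm1_gt0 {R : realType} {G : groupType} (f : G -> R) g :
  finite_set [set g | f g != 0%R] -> f g != 0%R -> (0 < norm1 f)%R.
Proof.
move=> fin fg; rewrite -lte_fin -norm1_esum//.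
apply: (@lt_le_trans _ _ `|f g|%:E); first by rewrite lte_fin normr_gt0.
apply: esum_ge; exists [set g]; first by split => //; exact: finite_set1.
by rewrite fsbig_set1.
Qed.

Lemma norm1_indic {R : realType} {I : groupType} (A : set I) : finite_set A ->
  norm1 (\1_A : I -> R) = (#|` fset_set A|%fset)%:R.
Proof.
move=> finA; rewrite /norm1 -(fsbig_widen A setT)//; last first.
  by move=> i [_ /= nA]; rewrite indicE memNset// normr0.
rewrite fsbig_finite// card_fset_sum1 natr_sum big_seq [RHS]big_seq.
by apply: eq_bigr => i; rewrite in_fset_set// indicE => ->; rewrite normr1.
Qed.

(** Markov's inequality for the counting measure. Applied to finite subsets of [A], it also excludes
    that [A] is infinite. *)
Lemma esum_ge1_card {R : realType} {I : choiceType} (u : I -> R) (A : set I) (r : R) :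
  (forall i, (0 <= u i)%R) -> (forall i, A i -> (1 <= u i)%R) ->
  \esum_(i in [set: I]) (u i)%:E <= r%:E ->
  finite_set A /\ ((#|` fset_set A|%fset)%:R <= r)%R.
Proof.
move=> u0 Au ur.
have cardB (B : {fset I}) : [set` B] `<=` A -> ((#|` B|%fset)%:R <= r)%R.
  move=> BA; rewrite -lee_fin; apply: le_trans ur; apply: esum_ge.
  exists [set` B]; first by split => //; exact: finite_fset.
  rewrite fsbig_finite//= set_fsetK.
  rewrite (_ : (#|` B|%fset)%:R%:E = \sum_(i <- B) 1%:E :> \bar R); last first.
    by rewrite sumEFin card_fset_sum1 natr_sum.
  rewrite big_seq [leRHS]big_seq; apply: lee_sum => i iB.
  by rewrite lee_fin; apply: Au; exact: BA.
have finA : finite_set A.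
  apply: contrapT => /(infinite_set_fset (Num.truncn `|r|).+1)[B BA].
  apply/negP; rewrite -ltnNge -(ltr_nat R) (le_lt_trans (cardB _ BA))//.
  by rewrite (le_lt_trans (ler_norm r))// truncnS_gt.
by split=> //; apply: cardB; rewrite fset_setK.
Qed.

(** If t is at most k / c, monotonicity of [phi] bounds the entry 2; otherwise the monotonicity of s
    / phi s bounds the entry k / t. The case k = 0 is separate because [phi] is controlled by
    monotonicity only at positive arguments. *)
Lemma min_le_phi_ratio {R : realType} (phi : R -> R)
  (phi_gt0 : forall t : R, (0 < t -> 0 < phi t)%R)
  (phi_mono : forall s t : R, (0 < s -> s <= t -> phi s <= phi t)%R)
  (phi_sublinear : forall s t : R, (0 < s -> s <= t -> s / phi s <= t / phi t)%R)
  (phi0_ge0 : (0 <= phi 0)%R) (c t k : R) :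
  (0 < c -> 0 < t -> 0 <= k ->
   Num.min 2 (k / t) <= (2 + c) / phi t * phi (k / c))%R.
Proof.
move=> c0 t0; rewrite le_eqVlt => /predU1P[<-|k0].
  by rewrite !mul0r minC min_l// mulr_ge0// divr_ge0 ?addr_ge0// ltW ?phi_gt0.
have pt := phi_gt0 _ t0; have kc : (0 < k / c)%R by rewrite divr_gt0.
have pk := phi_gt0 _ kc.
have [tk|kt] := leP t (k / c)%R.
  rewrite ge_min; apply/orP; left.
  rewrite mulrAC ler_pdivlMr// ler_pM ?(ltW pt)//; last exact: phi_mono.
  by rewrite lerDl ltW.
rewrite ge_min; apply/orP; right.
have := phi_sublinear _ _ kc (ltW kt).
rewrite ler_pdivrMr// => H.
rewrite ler_pdivrMr//.
apply: (@le_trans _ _ (c * (t / phi t * phi (k / c)))%R).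
  by move: H; rewrite ler_pdivrMr// mulrC.
rewrite (_ : _ * t = (2 + c) * (t / phi t * phi (k / c)))%R; last by ring.
by rewrite ler_wpM2r ?lerDr// mulr_ge0// ?divr_ge0// ltW.
Qed.

(** * Profile transfer when the coupling conditions hold without null sets *)

Section CleanCoupling.
Context {R : realType} (phi : R -> R).
Hypotheses (phi_gt0 : forall t : R, (0 < t -> 0 < phi t)%R)
  (phi_mono : forall s t : R, (0 < s -> s <= t -> phi s <= phi t)%R)
  (phi_sublinear : forall s t : R, (0 < s -> s <= t -> s / phi s <= t / phi t)%R)
  (phi0_ge0 : (0 <= phi 0)%R).
Context d (T : measurableType d) (mu : {measure set T -> \bar R}).
Context (G L : groupType) (aG : G -> T -> T) (aL : L -> T -> T) (X Y : set T).
Context (SG : {fset G}) (SL : {fset L}).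
Hypotheses (cG : countable [set: G]) (cL : countable [set: L]).
Hypotheses (mpG : measure_preserving_action mu aG)
  (mpL : measure_preserving_action mu aL)
  (commute : forall g l x, aG g (aL l x) = aL l (aG g x)).
Hypotheses (mX : measurable X) (finX : mu X < +oo) (X_gt0 : 0 < mu X)
  (mY : measurable Y).
Hypothesis Xuniq : forall l x, X x -> X (aL l x) -> aL l x = x.
Hypothesis Xcover : forall g x, X x -> exists l, X (aL l (aG g x)).
Hypothesis Yfree : forall g x, Y x -> Y (aG g x) -> g = 1%g.
Hypothesis Ycover : forall l x, X x -> exists g, Y (aG g (aL l x)).
Hypothesis SLinv : forall s, s \in SL -> (s^-1)%g \in SL.
(** The word [w x] spells the element of [L] taking the induced point of [X] back to [aG s x]; its
    length stands for the orbit distance. Its letters lie in a finite set, so it has countably many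
    values and all preimages can be asked to be measurable. *)
Hypothesis integrable : forall s : G, exists (c I : R) (w : T -> seq L),
  [/\ [/\ (0 < c)%R, (0 <= I)%R & forall B, measurable (w @^-1` B)],
      forall x, X x -> X (aL (\prod_(l <- w x) l)^-1%g (aG s x)),
      forall x, {subset w x <= SL} &
      \int[mu]_x (\1_X x * phi ((size (w x))%:R / c))%:E <= I%:E].

Let indic_ge0 (A : set T) x : (0 <= \1_A x :> R)%R.
Proof. by rewrite indicE ler0n. Qed.
#[local] Hint Resolve indic_ge0 : core.

Let phi_ge0 t : (0 <= t -> 0 <= phi t)%R.
Proof. by rewrite le_eqVlt => /predU1P[<-//|/phi_gt0/ltW]. Qed.

(** The two translation bounds give [norm1 f] times the minimum of 2 and size / t at each point of
    [X], and [min_le_phi_ratio] makes this integrable. The constant depends on [s] only, so it can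
    be fixed before [f] and [t]. *)
Lemma displacement_bound (s : G) : exists2 D : R, (0 <= D)%R &
  forall (f : L -> R) (t : R), (forall l, (0 <= f l)%R) ->
    finite_set [set l | f l != 0%R] -> (0 < t)%R ->
    (t * grad_norm1 SL f <= norm1 f)%R ->
    \int[mu]_x `|lift_fun aL X f (aG s x) - lift_fun aL X f x|%:E <=
    (D / phi t * norm1 f)%:E.
Proof.
have [c [I [w [[c0 I0 mw] wX wS intI]]]] := integrable s.
exists ((2 + c) * I)%R; first by rewrite mulr_ge0// addr_ge0// ltW.
move=> f t f0 finf t0 tf.
have N0 : (0 <= norm1 f)%R.
  by rewrite -lee_fin -norm1_esum//; apply: esum_ge0 => l _; rewrite lee_fin.
pose u x := ((\prod_(l <- w x) l)^-1)%g.
have mu' B : measurable (u @^-1` B).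
  exact: (mw [set v | B ((\prod_(l <- v) l)^-1)%g]).
apply: le_trans (integral_displacement cL mpL mX f0 finf mpG commute
  Xuniq Xcover mu' wX) _.
pose k := ((2 + c) / phi t * norm1 f)%R.
have k0 : (0 <= k)%R by rewrite !mulr_ge0// ?invr_ge0 ?ltW// ?addr_gt0 ?phi_gt0.
have mphi : measurable_fun setT (fun x => (\1_X x * phi ((size (w x))%:R / c))%:E).
  apply/measurable_EFinP; apply: measurable_funM; first exact: measurable_indic.
  move=> _ B mB; rewrite setTI; exact: (mw [set v | B (phi ((size v)%:R / c))]).
apply: (@le_trans _ _ (\int[mu]_x (k%:E * (\1_X x * phi ((size (w x))%:R / c))%:E))).
  apply: ge0_le_integral => //.
  - by move=> x _; rewrite mule_ge0// ?lee_fin// esum_ge0.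
  - apply: emeasurable_funM.
      by apply/measurable_EFinP; exact: measurable_indic.
    apply: measurable_esum => // l; apply/measurable_EFinP.
    move=> _ B mB; rewrite setTI.
    exact: (mu' [set v | B `|f (v * l)%g - f l|%R]).
  - exact: measurable_funeM.
  - move=> x _; rewrite indicE; case: (x \in X); last first.
      by rewrite mul0e mul0r mule0.
    rewrite mul1e mul1r.
    apply: (@le_trans _ _ (norm1 f * Num.min 2 ((size (w x))%:R / t))%:E); last first.
      rewrite -EFinM lee_fin /k mulrAC mulrC ler_wpM2r//.
      by apply: min_le_phi_ratio => //.
    have [_|_] := leP 2%R ((size (w x))%:R / t)%R.
      by rewrite mulrC EFinM -norm1_esum//; exact: esum_translate_le2.
    have := esum_translate_le f SLinv (wS x); rewrite grad_norm1_esum//.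
    move=> /le_trans; apply; rewrite -EFinM lee_fin mulrCA ler_wpM2l//.
    by rewrite ler_pdivlMr// mulrC.
rewrite ge0_integralZl_EFin//; last first.
  by move=> x _; rewrite lee_fin mulr_ge0// phi_ge0// divr_ge0// ltW.
have -> : ((2 + c) * I / phi t * norm1 f)%:E = k%:E * I%:E.
  by rewrite -EFinM /k; congr EFin; ring.
by rewrite lee_wpmul2l// lee_fin.
Qed.

Lemma total_displacement_bound : exists2 D : R, (0 <= D)%R &
  forall (f : L -> R) (t : R), (forall l, (0 <= f l)%R) ->
    finite_set [set l | f l != 0%R] -> (0 < t)%R ->
    (t * grad_norm1 SL f <= norm1 f)%R ->
    \sum_(s <- SG) \int[mu]_x `|lift_fun aL X f (aG s x) - lift_fun aL X f x|%:E <=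
    (D / phi t * norm1 f)%:E.
Proof.
elim: (enum_fset SG) => [|s S [D D0 IH]].
  by exists 0%R => // f t _ _ _ _; rewrite big_nil !mul0r.
have [E E0 HE] := displacement_bound s.
exists (E + D)%R => [|f t f0 finf t0 tf]; first exact: addr_ge0.
by rewrite big_cons !mulrDl EFinD leeD// ?HE// IH.
Qed.

Lemma norm1_le_of_profile (f : G -> R) (k r : R) : (0 < k)%R ->
  finite_set [set g | f g != 0%R] ->
  ((#|` fset_set [set g | f g != 0%R]|%fset)%:R <= r)%R ->
  iso_profile SG r <= k%:E -> (norm1 f <= k * grad_norm1 SG f)%R.
Proof.
move=> k0 finf fr prof.
have grad0 : (0 <= grad_norm1 SG f)%R.
  rewrite -lee_fin -grad_norm1_esum//; apply: esum_ge0 => g _.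
  by rewrite lee_fin sumr_ge0.
have [[g fg]|nf] := pselect (exists g, f g != 0%R); last first.
  rewrite /norm1 fsbig1 ?mulr_ge0 ?(ltW k0)// => g _.
  by apply/eqP; rewrite normr_eq0; apply: contrapT => /negP fg; apply: nf; exists g.
have : profile_ratio SG f <= k%:E.
  apply: le_trans prof; apply: ereal_sup_ubound; exists f => //=.
  by split => //; exists g.
(* A vanishing gradient would make the ratio infinite, against the finite bound [k]. *)
rewrite /profile_ratio; case: eqP => [_|/eqP grad_neq0]; first by rewrite leye_eq.
by rewrite lee_fin ler_pdivrMr// lt0r grad_neq0.
Qed.

(** By contradiction: a small profile of [G] bounds the norm by the gradient on every orbit with
    small support. Integrated over [Y], this bounds half of the mass of the lift by its total
    displacement, which is too small. *)
Lemma profile_transfer : exists C K : R, [/\ (0 < C)%R, (0 < K)%R &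
  forall (n : nat) (f : L -> R) (t : R), (0 < n)%N ->
    (forall l, (0 <= f l)%R) -> (exists l, f l != 0%R) ->
    finite_set [set l | f l != 0%R] ->
    (#|` fset_set [set l | f l != 0%R]|%fset <= n)%N -> (0 < t)%R ->
    (t * grad_norm1 SL f <= norm1 f)%R ->
    (phi t)%:E <= K%:E * iso_profile SG (C * n%:R)%R].
Proof.
have XY x : X x -> exists g, Y (aG g x).
  by move=> /(Ycover 1%g); case: mpL => -[-> _] _ _.
have [C C0 conc] := orbit_sum_concentration cG mpG mX finX mY Yfree XY X_gt0.
have [D D0 HD] := total_displacement_bound.
have Xfin : mu X \is a fin_num by rewrite ge0_fin_numE.
have m0 : (0 < fine (mu X))%R by rewrite fine_gt0// X_gt0.
(* Half of K mu(X) is then D + mu(X) / 2, strictly above [D], which is the final contradiction. *)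
pose K := (2 * D / fine (mu X) + 1)%R.
have K0 : (0 < K)%R by rewrite ltr_wpDl// !mulr_ge0// invr_ge0 ltW.
exists C, K; split => // n f t n0 f0 [l0 fl0] finf fn t0 tf.
have pt := phi_gt0 t0.
have N0 : (0 < norm1 f)%R := norm1_gt0 finf fl0.
rewrite leNgt; apply/negP => profK.
set r := (C * n%:R)%R in profK.
have {profK} prof : iso_profile SG r <= (phi t / K)%:E.
  case: (iso_profile SG r) profK => [q||].
  - by rewrite -EFinM lte_fin lee_fin ler_pdivlMr// mulrC => /ltW.
  - by rewrite gt0_muley ?lte_fin.
  - by move=> _; exact: leNye.
set h := lift_fun aL X f.
have h0 x : (0 <= h x)%R by exact: lift_fun_ge0.
have mh : measurable_fun setT h by exact: (measurable_lift_fun cL mpL).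
pose supp : set L := [set l | f l != 0%R].
(* The lift [u] of the indicator of the support is at least 1 wherever [h] is nonzero, so its orbit
   sums bound the size of the support of [h] along orbits. *)
pose u : T -> R := lift_fun aL X (\1_supp).
have fin1 : finite_set [set l | (\1_supp l : R) != 0%R].
  apply: sub_finite_set finf => l /=; rewrite indicE.
  by case: (boolP (l \in supp)) => [|_]; rewrite ?eqxx// inE.
have u0 x : (0 <= u x)%R by exact: lift_fun_ge0.
have mu1 : measurable_fun setT u by exact: (measurable_lift_fun cL mpL).
have u_ge1 x : h x != 0%R -> (1 <= u x)%R.
  move=> hx; have [l []] : exists l, f l != 0%R /\ X (aL l x).
    apply: contrapT => nl; move: hx; rewrite /h /lift_fun fsbig1 ?eqxx// => l _.
    have [->|fl] := eqVneq (f l) 0%R; first by rewrite mul0r.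
    rewrite indicE memNset ?mulr0// => Xl; apply: nl; exists l; split => //.
  move=> fl Xl; rewrite -lee_fin /u lift_fun_esum//; apply: esum_ge.
  exists [set l]; first by split => //; exact: finite_set1.
  by rewrite fsbig_set1 !indicE (mem_set Xl) mulr1 mem_set.
(* [B] gathers the orbits on which the support may be too large; [v] is [h] cut off on this
   invariant set. *)
pose B := [set x | r%:E < orbit_sum aG u x].
have mB : measurable B.
  rewrite -[B]setTI; apply: emeasurable_fun_o_infty => //.
  exact: (measurable_orbit_sum cG mpG).
have BG g x : B (aG g x) <-> B x by rewrite /B /= (orbit_sum_act mpG).
pose v x : R := (h x * \1_(~` B) x)%R.
have v0 x : (0 <= v x)%R by rewrite mulr_ge0.
have mv : measurable_fun setT v.
  by apply: measurable_funM => //; apply: measurable_indic; exact: measurableC.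
have hY x : h x != 0%R -> exists g, Y (aG g x).
  move=> hx; have [l Xl] : exists l, X (aL l x).
    apply: contrapT => nl; move: hx; rewrite /h /lift_fun fsbig1 ?eqxx// => l _.
    by rewrite indicE memNset ?mulr0// => Xl; apply: nl; exists l.
  by have [g] := Ycover l^-1%g Xl; rewrite (actK mpL) => Yg; exists g.
pose del s x : R := `|h (aG s x) - h x|%R.
have del0 s x : (0 <= del s x)%R by exact: normr_ge0.
have mdel s : measurable_fun setT (del s).
  apply: measurableT_comp => //; apply: measurable_funB => //.
  by apply: measurableT_comp => //; case: mpG.
(* The mass of [h] splits into pieces over [X] indexed by [l]. For each of them the concentration
   estimate applies to [u] translated by [l^-1], whose integral is at most n mu(X), so at least half
   of every piece survives. *)
have lower : 2^-1%:E * mu X * (norm1 f)%:E <= \int[mu]_x (v x)%:E.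
  rewrite (integral_lift_fun cL mpL mX f0 finf)//; last first.
    by apply: measurable_indic; exact: measurableC.
  rewrite -norm1_esum// (_ : _ * _ * _ =
      \esum_(l in [set: L]) ((2^-1%:E * mu X) * `|f l|%:E)); last first.
    by rewrite -(fineK Xfin) -EFinM ge0_esumZl// mulr_ge0// ltW.
  apply: le_esum => l _; rewrite ger0_norm// muleC lee_wpmul2l ?lee_fin//.
  pose ul x := u (aL l^-1%g x).
  have ul0 x : (0 <= ul x)%R by exact: u0.
  pose Bl := [set x | r%:E < orbit_sum aG ul x].
  have BlE x : B (aL l^-1%g x) <-> Bl x.
    rewrite /B /Bl /=; suff -> : orbit_sum aG u (aL l^-1%g x) = orbit_sum aG ul x by [].
    by apply: eq_esum => g _; rewrite commute.
  have mul : measurable_fun setT ul.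
    by apply: measurableT_comp => //; case: mpL.
  have mBl : measurable Bl.
    rewrite -[Bl]setTI; apply: emeasurable_fun_o_infty => //.
    exact: (measurable_orbit_sum cG mpG).
  have XBl : mu (X `&` Bl) <= 2^-1%:E * mu X.
    apply: conc => //; first by rewrite ltr0n.
    rewrite (ge0_integral_act mpL l^-1%g (f := fun x => (u x)%:E))//; last first.
      exact/measurable_EFinP.
    rewrite integral_lift_funT// lee_wpmul2r// lee_fin norm1_indic//.
    by rewrite ler_nat.
  have -> : \int[mu]_x (\1_X x * \1_(~` B) (aL l^-1%g x))%:E = mu (X `\` Bl).
    rewrite -[X `\` Bl]setIT -integral_indic//; last exact: measurableD.
    apply: eq_integral => x _; rewrite !indicE -natrM mulnb setDE in_setI.
    suff -> : (aL l^-1%g x \in ~` B) = (x \in ~` Bl) by [].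
    rewrite !in_setC; congr negb.
    apply/idP/idP => /set_mem xB; apply/mem_set.
      by apply (BlE x).1.
    by apply (BlE x).2.
  have finD : mu (X `\` Bl) \is a fin_num.
    rewrite ge0_fin_numE//; apply: le_lt_trans finX.
    by apply: le_measure; rewrite ?inE ?subDsetl//; exact: measurableD.
  have finI : mu (X `&` Bl) \is a fin_num.
    rewrite ge0_fin_numE//; apply: le_lt_trans finX.
    by apply: le_measure; rewrite ?inE ?subIsetl//; exact: measurableI.
  have : mu X = mu (X `\` Bl) + mu (X `&` Bl) by exact: measureDI.
  move: XBl; rewrite -(fineK Xfin) -(fineK finD) -(fineK finI) -EFinD -!EFinM.
  by rewrite !lee_fin => XBl [XE]; lra.
(* On an orbit inside [B] the left side is 0. On any other, the support of [h] read along the orbit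
   has at most [r] elements and the assumed bound on the profile applies. *)
have point x : (\1_Y x)%:E * orbit_sum aG v x <=
    (phi t / K)%:E * \sum_(s <- SG) ((\1_Y x)%:E * orbit_sum aG (del s) x).
  rewrite -ge0_sume_distrr; last first.
    by move=> s _; apply: orbit_sum_ge0 => y; exact: normr_ge0.
  rewrite muleCA lee_wpmul2l ?lee_fin//.
  have sum0 : 0 <= \sum_(s <- SG) orbit_sum aG (del s) x.
    by apply: sume_ge0 => s _; rewrite orbit_sum_ge0// => y; exact: normr_ge0.
  have [Bx|nBx] := pselect (B x).
    rewrite [orbit_sum _ v _]esum1 ?mule_ge0 ?lee_fin ?divr_ge0 ?(ltW pt) ?(ltW K0)//.
    by move=> g _; rewrite /v indicE memNset ?mulr0// => /(_ ((BG g x).2 Bx)).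
  pose hx g := h (aG g x).
  have [finhx cardhx] : finite_set [set g | hx g != 0%R] /\
      ((#|` fset_set [set g | hx g != 0%R]|%fset)%:R <= r)%R.
    apply: (@esum_ge1_card _ _ (fun g => u (aG g x))) => // [g /u_ge1//|].
    by rewrite leNgt; apply/negP.
  have := norm1_le_of_profile (divr_gt0 pt K0) finhx cardhx prof.
  rewrite -lee_fin EFinM -norm1_esum// -grad_norm1_esum//.
  rewrite (_ : \esum_(g in _) (\sum_(s <- SG) _)%:E =
      \sum_(s <- SG) orbit_sum aG (del s) x); last first.
    rewrite /orbit_sum -esum_sum; last by move=> g s _ _; rewrite lee_fin normr_ge0.
    apply: eq_esum => g _; rewrite -sumEFin.
    apply: eq_bigr => s _; rewrite /del /hx.
    by have [[_ ->] _ _] := mpG.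
  move=> le_norm; apply: le_trans le_norm; apply: le_esum => g _.
  rewrite lee_fin /v /hx indicE ger0_norm//.
  by case: (_ \in _); rewrite ?mulr1// mulr0.
have upper : \int[mu]_x (v x)%:E <=
    (phi t / K)%:E * \sum_(s <- SG) \int[mu]_x (del s x)%:E.
  rewrite -(integral_domain cG mpG mY Yfree)//; last first.
    by move=> x; rewrite mulf_eq0 negb_or => /andP[/hY].
  (* If [del s x] is nonzero, then [h] is nonzero at [x] or at [aG s x], and in both cases the orbit
     of [x] meets [Y]. *)
  have E s : \int[mu]_x (del s x)%:E =
      \int[mu]_x ((\1_Y x)%:E * orbit_sum aG (del s) x).
    rewrite (integral_domain cG mpG mY Yfree)// => x.
    have [hx|/hY//] := eqVneq (h x) 0%R.
    have [hsx|/hY[g Yg _]] := eqVneq (h (aG s x)) 0%R.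
      by rewrite /del hx hsx subrr normr0 eqxx.
    by exists (g * s)%g; have [[_ ->] _ _] := mpG.
  under eq_bigr do rewrite E.
  have mO s : measurable_fun setT (fun x => (\1_Y x)%:E * orbit_sum aG (del s) x).
    apply: emeasurable_funM.
      by apply/measurable_EFinP; exact: measurable_indic.
    exact: (measurable_orbit_sum cG mpG).
  have O0 s x : 0 <= (\1_Y x)%:E * orbit_sum aG (del s) x.
    by rewrite mule_ge0 ?lee_fin// orbit_sum_ge0.
  rewrite -ge0_integral_sum// -ge0_integralZl_EFin//.
  - apply: ge0_le_integral => //.
    + by move=> x _; rewrite mule_ge0 ?lee_fin// orbit_sum_ge0.
    + apply: emeasurable_funM.
        by apply/measurable_EFinP; exact: measurable_indic.
      exact: (measurable_orbit_sum cG mpG).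
    + by apply: measurable_funeM; exact: emeasurable_sum.
  - by move=> x _; apply: sume_ge0.
  - exact: emeasurable_sum.
  - by rewrite divr_ge0 ?(ltW pt) ?(ltW K0).
have ptK : 0 <= (phi t / K)%:E by rewrite lee_fin divr_ge0 ?(ltW pt) ?(ltW K0).
have := le_trans lower (le_trans upper (lee_wpmul2l ptK (HD f t f0 finf t0 tf))).
rewrite -(fineK Xfin) -!EFinM lee_fin.
rewrite (_ : phi t / K * _ = D / K * norm1 f)%R; last first.
  by field; rewrite ?gt_eqF.
rewrite ler_pM2r// ler_pdivlMr// /K mulrDr mulr1.
rewrite (_ : 2^-1 * _ * (2 * D / _) = D)%R; last by field; rewrite gt_eqF.
by rewrite gerDl leNgt mulr_gt0.
Qed.

End CleanCoupling.

(** * Reduction of a coupling to one without exceptional null sets *)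

Lemma sub_mem_map_val {K : choiceType} (S : {fset K}) (w : seq K) :
  {subset w <= S} -> exists v : seq S, w = map val v.
Proof.
elim: w => [|x w IH] wS; first by exists [::].
have [|v ->] := IH; first by move=> y yw; apply: wS; rewrite inE yw orbT.
have xS : x \in S by apply: wS; rewrite mem_head.
by exists ([` xS]%fset :: v).
Qed.

(** Words over the finite type [S] form a countable type whose products cover [G]. *)
Lemma symmetric_generating_countable (G : groupType) (S : {fset G}) :
  symmetric_generating S -> countable [set: G].
Proof.
move=> [_ genS].
rewrite (_ : setT = (fun w : seq S => \prod_(s <- map val w) s)%g @` setT).
  by apply: card_le_trans (card_image_le _ _) _; exact: countableP.
apply/seteqP; split => // g _; have [w /sub_mem_map_val[v ->] ->] := genS g.
by exists v.
Qed.

(** The integral of a nonnegative function is a supremum over the simple functions below it, so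
    comparison requires no measurability. This matters for the integrand built from [orbit_dist]. *)
Lemma ge0_le_integral_nonmeasurable {R : realType} d (T : measurableType d)
    (mu : {measure set T -> \bar R}) (f g : T -> \bar R) :
  (forall x, 0 <= f x) -> (forall x, f x <= g x) ->
  \int[mu]_x f x <= \int[mu]_x g x.
Proof.
move=> f0 fg; have g0 x : 0 <= g x by exact: le_trans (fg x).
rewrite !ge0_integralTE//; apply: le_ereal_sup => _ [h hf <-].
by exists h => // x; exact: le_trans (hf x) (fg x).
Qed.

Lemma measure_countable_bigcup0 {R : realType} d (T : measurableType d)
    (mu : {measure set T -> \bar R}) (I : choiceType) (F : I -> set T) :
  countable [set: I] -> (forall i, measurable (F i)) -> (forall i, mu (F i) = 0) ->
  mu (\bigcup_i F i) = 0.
Proof.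
move=> cI mF F0; have mU := countable_bigcupT_measurable cI mF.
apply/eqP; rewrite eq_le measure_ge0 andbT -[X in mu X]setIT -integral_indic//.
apply: (@le_trans _ _ (\int[mu]_x (\esum_(i in [set: I]) (\1_(F i) x)%:E))).
  apply: ge0_le_integral_nonmeasurable => x; first by rewrite lee_fin indicE.
  rewrite indicE; case: (boolP (x \in _)) => [|_]; last first.
    by apply: esum_ge0 => i _; rewrite lee_fin indicE.
  rewrite inE => -[i _ Fx]; apply: esum_ge; exists [set i].
    by split => //; exact: finite_set1.
  by rewrite fsbig_set1 indicE mem_set.
rewrite ge0_integral_esum//.
- by rewrite esum1// => i _; rewrite integral_indic// setIT F0.
- by move=> i; apply/measurable_EFinP; exact: measurable_indic.
Qed.

Section Cleaning.
Context {R : realType} (phi : R -> R).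
Hypotheses (phi_gt0 : forall t : R, (0 < t -> 0 < phi t)%R)
  (phi_mono : forall s t : R, (0 < s -> s <= t -> phi s <= phi t)%R)
  (phi_sublinear : forall s t : R, (0 < s -> s <= t -> s / phi s <= t / phi t)%R)
  (phi0_ge0 : (0 <= phi 0)%R).
Context (G L : groupType) (SG : {fset G}) (SL : {fset L}).
Hypotheses (genG : symmetric_generating SG) (genL : symmetric_generating SL).
Context d (T : measurableType d) (mu : {measure set T -> \bar R}).
Context (aG : G -> T -> T) (aL : L -> T -> T) (XL : set T).
Hypothesis coupling : subquotient_coupling mu aG aL XL.
Hypothesis integrable : integrable_coupling mu aG aL phi SL XL.

Let cG : countable [set: G]. Proof. exact: symmetric_generating_countable genG. Qed.
Let cL : countable [set: L]. Proof. exact: symmetric_generating_countable genL. Qed.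
Let mpG : measure_preserving_action mu aG. Proof. by case: coupling. Qed.
Let mpL : measure_preserving_action mu aL. Proof. by case: coupling. Qed.
Let commute g l x : aG g (aL l x) = aL l (aG g x). Proof. by case: coupling. Qed.

(** The exceptional set is enlarged to the union of its preimages under all pairs of group elements:
    countably many null sets, permuted by both actions since these commute. *)
Lemma invariant_null_set (P : T -> Prop) : {ae mu, forall x, P x} ->
  exists N : set T, [/\ measurable N, mu N = 0, forall x, ~ N x -> P x,
    forall g x, ~ N x -> ~ N (aG g x) & forall l x, ~ N x -> ~ N (aL l x)].
Proof.
move=> [N0 [mN0 N00 PN0]].
have [[aG1 aGM] maG muG] := mpG; have [[aL1 aLM] maL muL] := mpL.
pose F (p : G * L) := aL p.2 @^-1` (aG p.1 @^-1` N0).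
have mF p : measurable (F p).
  by do 2 apply: (measurable_preimage_act (mu := mu)) => //.
have cGL : countable [set: G * L] by rewrite -setXTT; exact: countableX.
exists (\bigcup_p F p); split.
- exact: countable_bigcupT_measurable.
- apply: measure_countable_bigcup0 => // p.
  rewrite /F muL ?muG//; exact: (measurable_preimage_act mpG).
- move=> x nN; apply: contrapT => nP; apply: nN; exists (1%g, 1%g) => //.
  by rewrite /F /= aL1 aG1; exact: PN0.
- move=> g x nN [[h l] _]; rewrite /F /= -commute -aGM => Nx; apply: nN.
  by exists (h * g, l)%g.
- move=> k x nN [[h l] _]; rewrite /F /= -aLM => Nx; apply: nN.
  by exists (h, l * k)%g.
Qed.

(** Removing an invariant null set from both fundamental domains makes freeness, uniqueness and
    covering hold at every remaining point. A measurable choice of shortest words then replaces the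
    orbit distance. *)
Lemma coupling_profile_transfer : exists C K : R, [/\ (0 < C)%R, (0 < K)%R &
  forall (n : nat) (f : L -> R) (t : R), (0 < n)%N ->
    (forall l, (0 <= f l)%R) -> (exists l, f l != 0%R) ->
    finite_set [set l | f l != 0%R] ->
    (#|` fset_set [set l | f l != 0%R]|%fset <= n)%N -> (0 < t)%R ->
    (t * grad_norm1 SL f <= norm1 f)%R ->
    (phi t)%:E <= K%:E * iso_profile SG (C * n%:R)%R].
Proof.
have [_ _ mu_neq0 _ _ _ freeG [XG [mXG domG]] [mXL domL] finXL] := coupling.
have [[aG1 aGM] maG muG] := mpG; have [[aL1 aLM] maL muL] := mpL.
have [N [mN N0 NP NG NL]] := invariant_null_set (filterI freeG (filterI domG domL)).
pose X := XL `\` N; pose Y := XG `\` N.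
have mX : measurable X by exact: measurableD.
have mY : measurable Y by exact: measurableD.
have XLuniq x y z : ~ N x -> act_orbit aL x y -> act_orbit aL x z ->
    XL y -> XL z -> y = z.
  move=> /NP[_ [_ [u [_ uP]]]] xy xz Xy Xz.
  by rewrite -(uP y)// -(uP z).
have Xuniq l x : X x -> X (aL l x) -> aL l x = x.
  move=> [Xx nx] [Xlx _]; apply: (XLuniq x) => //; first by exists l.
  by exists 1%g.
have Xcover0 x : ~ N x -> exists l, X (aL l x).
  move=> nx; have [_ [_ [_ [[[l _ <-] Xl] _]]]] := NP _ nx.
  by exists l; split => //; exact: NL.
have Xcover g x : X x -> exists l, X (aL l (aG g x)).
  by move=> [_ nx]; apply: Xcover0; exact: NG.
have Yfree g x : Y x -> Y (aG g x) -> g = 1%g.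
  move=> [Yx nx] [Ygx _]; have [free [[u [_ uP]] _]] := NP _ nx.
  apply: free; rewrite -(uP (aG g x)); last by split => //; exists g.
  by apply: uP; split => //; exists 1%g.
have Ycover l x : X x -> exists g, Y (aG g (aL l x)).
  move=> [_ nx]; have nlx := NL l _ nx.
  have [_ [[_ [[[g _ <-] Yg] _]] _]] := NP _ nlx.
  by exists g; split => //; exact: NG.
have finX : mu X < +oo.
  by apply: le_lt_trans finXL; apply: le_measure; rewrite ?inE//; exact: subDsetl.
(* Countably many preimages of [X] under [L] cover the space up to [N], so a null [X] would force
   [mu] to vanish. *)
have X_gt0 : 0 < mu X.
  rewrite lt0e measure_ge0 andbT; apply/eqP => X0; apply: mu_neq0.
  have mlX l : measurable (aL l @^-1` X) by exact: (measurable_preimage_act mpL).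
  have -> : [set: T] = N `|` \bigcup_l (aL l @^-1` X).
    apply/seteqP; split => // x _; have [Nx|nx] := pselect (N x); [by left|right].
    by have [l Xl] := Xcover0 _ nx; exists l.
  have : mu (\bigcup_l (aL l @^-1` X)) = 0.
    by apply: measure_countable_bigcup0 => // l; rewrite muL.
  move=> U0; apply/eqP; rewrite eq_le measure_ge0 andbT.
  have : mu (N `|` \bigcup_l (aL l @^-1` X)) <= mu N + mu (\bigcup_l (aL l @^-1` X)).
    by apply: measureU2 => //; exact: countable_bigcupT_measurable.
  by rewrite N0 U0 adde0.
apply: (profile_transfer phi_gt0 phi_mono phi_sublinear phi0_ge0 SG cG cL mpG mpL
  commute mX finX X_gt0 mY Xuniq Xcover Yfree Ycover); first by case: genL.
move=> s; have [c c0 intc] := integrable s.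
set k := fun x => orbit_dist aL SL (Defs.induced aG aL XL s x) (aG s x) in intc.
have phi_ge0 n : (0 <= phi (n%:R / c))%R.
  have : (0 <= n%:R / c)%R by rewrite divr_ge0// ltW.
  by rewrite le_eqVlt => /predU1P[<-//|/phi_gt0/ltW].
pose back (v : seq L) x := aL (\prod_(l <- v) l)^-1%g (aG s x).
pose A (v : seq SL) := X `&` [set x | X (back (map val v) x)].
have mA v : measurable (A v).
  apply: measurableI => //; apply: (measurable_preimage_act mpG s (A := _ @^-1` X)).
  exact: (measurable_preimage_act mpL).
have [w mw wP] := measurable_least_index [::] size mA.
have wA x : X x -> A (w x) x.
  move=> Xx; have [l Xl] := Xcover s x Xx.
  have [_ /(_ l^-1%g)[u uS lE]] := genL.
  have [v vE] := sub_mem_map_val uS.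
  suff /wP[] : A v x by [].
  by split => //=; rewrite /back -vE -lE invgK.
have kE x : X x -> k x = size (w x).
  move=> Xx; have [_ Xw] := wA x Xx; have [XLx nx] := Xx.
  have yE : Defs.induced aG aL XL s x = back (map val (w x)) x.
    have ex : (act_orbit aL (aG s x) `&` XL) (back (map val (w x)) x).
      by split; [eexists|case: Xw].
    have [] := xgetPex x (ex_intro _ _ ex).
    rewrite -/(Defs.induced aG aL XL s x) => oi Xi.
    by apply: (XLuniq (aG s x)) => //; [exact: NG|case: ex|case: Xw].
  have reach v : aG s x = aL (\prod_(l <- v) l)%g (Defs.induced aG aL XL s x) <->
      back v x = Defs.induced aG aL XL s x.
    by split=> [E|<-]; [rewrite /back E (actK mpL)|rewrite /back (actVK mpL)].
  rewrite /k /orbit_dist; case: pselect => [ex|[]]; last first.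
    exists (size (w x)); apply/asboolP; exists (map val (w x)); split.
    - by move=> l /mapP[l' _ ->]; exact: valP.
    - by rewrite size_map.
    - by apply/reach; rewrite yE.
  case: ex_minnP => n /asboolP[v [vS <- /reach vE]] nmin.
  apply/eqP; rewrite eqn_leq; apply/andP; split.
    apply: nmin; apply/asboolP; exists (map val (w x)); split.
    - by move=> l /mapP[l' _ ->]; exact: valP.
    - by rewrite size_map.
    - by apply/reach; rewrite yE.
  have [v' v'E] := sub_mem_map_val vS; rewrite v'E size_map.
  suff /wP[] : A v' x by [].
  by split => //=; rewrite -v'E vE yE.
have int0 : 0 <= \int[mu]_(x in XL) (phi ((k x)%:R / c))%:E.
  by apply: integral_ge0 => x _; rewrite lee_fin.
exists c, (fine (\int[mu]_(x in XL) (phi ((k x)%:R / c))%:E)).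
exists (fun x => map val (w x)); split.
- split=> // [|B]; first exact: fine_ge0.
  exact: (mw [set v | B (map val v)]).
- by move=> x /wA[].
- by move=> x l /mapP[l' _ ->]; exact: valP.
rewrite fineK ?ge0_fin_numE// [leRHS]integral_mkcond.
apply: ge0_le_integral_nonmeasurable => x.
  by rewrite lee_fin mulr_ge0// indicE ler0n.
rewrite patchE indicE; case: (boolP (x \in X)) => [|_].
  by rewrite inE => Xx; rewrite mul1r kE// size_map mem_set//; case: Xx.
by rewrite mul0r; case: ifP => _; rewrite // lee_fin.
Qed.

End Cleaning.

(** * Positivity of the profile and nonnegative witnesses *)

Section Profile.
Context {R : realType} {G : groupType} (S : {fset G}).
Implicit Type f : G -> R.

Lemma grad_norm1_abs f : finite_set [set g | f g != 0%R] ->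
  (grad_norm1 S (fun g => `|f g|%R) <= grad_norm1 S f)%R.
Proof.
move=> fin; rewrite -lee_fin -!grad_norm1_esum//; last first.
  by apply: sub_finite_set fin => g /=; rewrite normr_eq0.
apply: le_esum => g _; rewrite lee_fin; apply: ler_sum => s _.
exact: ler_dist_dist.
Qed.

(** The point mass at the identity is a competitor. Positivity keeps the profile away from the
    arguments at which [ext_fun] or [phi] takes arbitrary values. *)
Lemma iso_profile_gt0 (n : nat) : (0 < n)%N -> 0 < iso_profile (R := R) S n%:R.
Proof.
move=> n0; pose e : G -> R := \1_[set 1%g].
have e1 : e 1%g != 0%R by rewrite /e indicE mem_set// oner_eq0.
have suppe : [set g | e g != 0%R] = [set 1%g].
  apply/seteqP; split => [g /=|_ -> //]; rewrite /e indicE.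
  by case: (boolP (g \in _)) => [|_]; [rewrite inE|rewrite eqxx].
have fine_ : finite_set [set g | e g != 0%R] by rewrite suppe; exact: finite_set1.
apply: (@lt_le_trans _ _ (profile_ratio S e)).
  rewrite /profile_ratio; case: eqP => [_|/eqP grad0]; first exact: ltry.
  rewrite lte_fin divr_gt0//; first exact: norm1_gt0 fine_ e1.
  rewrite lt0r grad0 /= -lee_fin -grad_norm1_esum//.
  by apply: esum_ge0 => g _; rewrite lee_fin sumr_ge0.
apply: ereal_sup_ubound; exists e => //; split => //; first by exists 1%g.
by rewrite suppe fset_set1 cardfs1 ler_nat.
Qed.

(** The absolute value of a competitor has the same norm and support and no larger gradient. Writing
    the ratio bound as a product also covers a vanishing gradient. *)
Lemma iso_profile_witness (n : nat) (t : R) : (0 < t)%R ->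
  t%:E < iso_profile S n%:R ->
  exists f, [/\ (forall g, (0 <= f g)%R), (exists g, f g != 0%R),
    finite_set [set g | f g != 0%R],
    (#|` fset_set [set g | f g != 0%R]|%fset <= n)%N &
    (t * grad_norm1 S f <= norm1 f)%R].
Proof.
move=> t0 /ereal_sup_gt[_ [f [[g fg] fin card_le] <-] tf].
have suppE : [set g | `|f g|%R != 0%R] = [set g | f g != 0%R].
  by apply/eq_set => h; rewrite normr_eq0.
have norm1E : norm1 (fun g => `|f g|%R) = norm1 f.
  by apply: eq_fsbigr => h _; rewrite normr_id.
exists (fun g => `|f g|%R); rewrite suppE norm1E; split => //.
- by exists g; rewrite normr_eq0.
- by rewrite -(ler_nat R).
- move: tf; rewrite /profile_ratio; case: eqP => [grad0 _|/eqP grad0 tf].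
    rewrite (le_trans _ (ltW (norm1_gt0 fin fg)))// pmulr_rle0//.
    by rewrite -grad0 grad_norm1_abs.
  apply: (@le_trans _ _ (t * grad_norm1 S f)%R).
    by rewrite ler_wpM2l ?(ltW t0)// grad_norm1_abs.
  move: tf; rewrite lte_fin ltr_pdivlMr; first exact: ltW.
  rewrite lt0r grad0 /= -lee_fin -grad_norm1_esum//.
  by apply: esum_ge0 => h _; rewrite lee_fin sumr_ge0.
Qed.

End Profile.

(* Comparison of the two profiles *)
Local Close Scope ereal_scope.

Theorem theorem4p4 (R : realType) (phi : R -> R)
  (phi_gt0 : forall t : R, 0 < t -> 0 < phi t)
  (phi_mono : forall s t : R, 0 < s -> s <= t -> phi s <= phi t)
  (phi_sublinear : forall s t : R, 0 < s -> s <= t -> s / phi s <= t / phi t)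
  (* the value at 0 is arbitrary in [0, inf phi] *)
  (phi0_ge0 : 0 <= phi 0) (phi0_le : forall t : R, 0 < t -> phi 0 <= phi t)
  (Gamma Lambda : groupType) (SGamma : {fset Gamma}) (SLambda : {fset Lambda})
  (hSGamma : symmetric_generating SGamma)
  (hSLambda : symmetric_generating SLambda)
  (hcoupling :
     integrable_quotient phi Gamma SLambda \/
     (exists m : nat, at_most_to_one_integrable_subquotient m phi Gamma SLambda)) :
  dominates (iso_profile SGamma)
    (fun t : R => ext_fun phi (iso_profile SLambda t)).
Proof.
(* Each of the two situations supplies a [phi]-integrable sub-quotient coupling. *)
have [d [T [mu [aG [aL [X [cpl int]]]]]]] :
    exists (d : measure_display) (T : measurableType d)
      (mu : {measure set T -> \bar R}) (aG : Gamma -> T -> T)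
      (aL : Lambda -> T -> T) (X : set T),
      subquotient_coupling mu aG aL X /\ integrable_coupling mu aG aL phi SLambda X.
  case: hcoupling => [[d [T [mu [aG [aL [X [[? _] ?]]]]]]]|].
    by exists d, T, mu, aG, aL, X.
  by move=> [_ [d [T [mu [aG [aL [X [? ? _]]]]]]]]; exists d, T, mu, aG, aL, X.
have [C [K [C0 K0 transfer]]] := coupling_profile_transfer
  phi_gt0 phi_mono phi_sublinear phi0_ge0 hSGamma hSLambda cpl int.
(* The supremum [r] need not be attained, so witnesses are taken at level r / 2; the factor 2 pays
   for this, as phi r is at most 2 phi (r / 2) by [phi_sublinear]. *)
exists C, (2 * K); split => //; first by rewrite mulr_gt0.
exists 1%N => // n /= n0; set p := iso_profile SGamma _.
have le_p t : 0 < t -> (t%:E < iso_profile SLambda n%:R)%E ->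
    ((2 * phi t)%:E <= (2 * K)%:E * p)%E.
  move=> t0 /(iso_profile_witness t0)[f [f0 fneq0 fin fn tf]].
  by rewrite !EFinM -muleA lee_wpmul2l//; exact: transfer tf.
have /= := iso_profile_gt0 (R := R) SLambda n0.
case: (iso_profile SLambda n%:R) le_p => [r| |] //= le_p.
  rewrite lte_fin => r0; have r20 : 0 < r / 2 by rewrite divr_gt0.
  apply: le_trans (le_p (r / 2) r20 _); last first.
    by rewrite lte_fin ltr_pdivrMr// mulr2n mulrDr mulr1 ltrDl.
  rewrite lee_fin; have p2 := phi_gt0 _ r20; have pr := phi_gt0 _ r0.
  have : r / 2 / phi (r / 2) <= r / phi r by apply: phi_sublinear => //; lra.
  rewrite ler_pdivlMr// mulrAC ler_pdivrMr// => sub.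
  by rewrite -(ler_pM2l r20); lra.
(* For an infinite profile every positive [t] has a witness, which bounds the supremum of [phi]. *)
move=> _; apply: ge_ereal_sup => _ [t /= t0 <-].
apply: le_trans (le_p t t0 (ltry _)); rewrite lee_fin.
by rewrite ler_peMl ?ler1n// ltW// phi_gt0.
Qed.
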